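(* SP-MVE admits a linear-time computable problem kernel with at most $5f+2$ vertices and $6f+2$ edges, where $f$ is the size of a (given) feedback edge set of the input graph.
   Context: SP-MVE is the decision problem: given an undirected graph $G=(V,E)$ with positive integer edge lengths $\tau\colon E\to\mathbb{N}$, vertices $s,t\in V$, and integers $k,\ell$, decide whether there is $S\subseteq E$ with $|S|\le k$ such that every $st$-path in $G-S$ has length (sum of edge lengths) at least $\ell$. A feedback edge set of $G$ is an edge set $F\subseteq E$ such that $G-F$ is a forest. A problem kernel of size bounded by $g$ is a (here linear-time) transformation of an instance into an equivalent SP-MVE instance (yes iff yes) whose size is bounded by $g$ of the parameter. *)

(* Defs.v *)
From mathcomp Require Import all_boot all_order all_algebra.

Set Implicit Arguments.
Unset Strict Implicit.
Unset Printing Implicit Defensive.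

Import GRing.Theory Num.Theory.

(** * Graphs with edge lengths

    An edge of a simple undirected graph on [V] is a two-element set of
    vertices, and the graph is given by its edge set. *)

Section Graph.
Variable V : finType.
Implicit Types (E : {set {set V}}) (x y : V) (p c : seq V).

Definition simple_graph E : Prop := forall e, e \in E -> #|e| = 2.

Definition adj E : rel V := fun x y => [set x; y] \in E.

(* The path is [x :: p]; in particular it is a single vertex when [p] is empty. *)
Definition is_path E x y p : Prop :=
  [/\ path (adj E) x p, last x p = y & uniq (x :: p)].

Definition path_length (tau : {set V} -> nat) x p : nat :=
  sumn (pairmap (fun u v => tau [set u; v]) x p).

(* [ucycle] also accepts closed walks u, v, u along one edge, which are not
   cycles of a simple graph; hence the length condition. *)
Definition is_forest E : Prop :=
  forall c, ucycle (adj E) c -> size c < 3.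

Definition feedback_edge_set E (F : {set {set V}}) : Prop :=
  F \subset E /\ is_forest (E :\: F).

End Graph.

(* Only the values of [len] on [edges] are meaningful. *)
Record instance := Instance {
  nv : nat;
  edges : {set {set 'I_nv}};
  len : {set 'I_nv} -> nat;
  src : 'I_nv;
  tgt : 'I_nv;
  budget : int;
  bound : int;
  edges_simple : simple_graph edges;
  len_gt0 : forall e, e \in edges -> 0 < len e
}.

Arguments len : clear implicits.

Definition sp_mve (I : instance) : Prop :=
  exists S : {set {set 'I_(nv I)}},
    [/\ S \subset edges I,
        (#|S|%:Z <= budget I)%R
      & forall p, is_path (edges I :\: S) (src I) (tgt I) p ->
          (bound I <= (path_length (len I) (src I) p)%:Z)%R].

(** * Random access machine

    A structured form of the random access machine with integer registers,
    addition and subtraction, under the uniform cost criterion.  A program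
    mentions finitely many variables and arrays (both named by numbers);
    arrays are unbounded and indexed by integers.  Multiplication is
    deliberately absent, so that unit cost is a reasonable measure. *)

Inductive expr :=
| Cst of int
| Var of nat
| Get of nat & expr
| Add of expr & expr
| Sub of expr & expr.

Inductive test :=
| Le of expr & expr
| Eq of expr & expr
| Not of test.

Inductive cmd :=
| Skip
| Assign of nat & expr
| Put of nat & expr & expr (* [Put a i e] stores [e] in cell [i] of array [a] *)
| Seq of cmd & cmd
| If of test & cmd & cmd
| While of test & cmd.

Record state := State {
  var : nat -> int;
  arr : nat -> int -> int
}.

Definition set_var (st : state) (x : nat) (v : int) : state :=
  State (fun y => if y == x then v else var st y) (arr st).

Definition set_arr (st : state) (a : nat) (i v : int) : state :=
  State (var st)
    (fun b j => if (b == a) && (j == i) then v else arr st b j).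

Fixpoint eval (st : state) (e : expr) : int :=
  match e with
  | Cst z => z
  | Var x => var st x
  | Get a i => arr st a (eval st i)
  | Add e1 e2 => (eval st e1 + eval st e2)%R
  | Sub e1 e2 => (eval st e1 - eval st e2)%R
  end.

Fixpoint holds (st : state) (b : test) : bool :=
  match b with
  | Le e1 e2 => (eval st e1 <= eval st e2)%R
  | Eq e1 e2 => eval st e1 == eval st e2
  | Not b => ~~ holds st b
  end.

Fixpoint expr_cost (e : expr) : nat :=
  match e with
  | Cst _ | Var _ => 1
  | Get _ i => (expr_cost i).+1
  | Add e1 e2 | Sub e1 e2 => (expr_cost e1 + expr_cost e2).+1
  end.

Fixpoint test_cost (b : test) : nat :=
  match b with
  | Le e1 e2 | Eq e1 e2 => (expr_cost e1 + expr_cost e2).+1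
  | Not b => (test_cost b).+1
  end.

(* [exec c st n st']: started in [st], [c] halts in [st'] after [n] steps. *)
Inductive exec : cmd -> state -> nat -> state -> Prop :=
| ExecSkip st : exec Skip st 1 st
| ExecAssign x e st :
    exec (Assign x e) st (expr_cost e).+1 (set_var st x (eval st e))
| ExecPut a i e st :
    exec (Put a i e) st (expr_cost i + expr_cost e).+1
         (set_arr st a (eval st i) (eval st e))
| ExecSeq c1 c2 st1 st2 st3 n1 n2 :
    exec c1 st1 n1 st2 -> exec c2 st2 n2 st3 ->
    exec (Seq c1 c2) st1 (n1 + n2) st3
| ExecIfTrue b c1 c2 st st' n :
    holds st b -> exec c1 st n st' ->
    exec (If b c1 c2) st (test_cost b + n) st'
| ExecIfFalse b c1 c2 st st' n :
    ~~ holds st b -> exec c2 st n st' ->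
    exec (If b c1 c2) st (test_cost b + n) st'
| ExecWhileFalse b c st :
    ~~ holds st b -> exec (While b c) st (test_cost b) st
| ExecWhileTrue b c st1 st2 st3 n1 n2 :
    holds st1 b -> exec c st1 n1 st2 -> exec (While b c) st2 n2 st3 ->
    exec (While b c) st1 (test_cost b + n1 + n2) st3.

Definition input_array : nat := 0.
Definition output_array : nat := 1.

Definition init_state (input : seq int) : state :=
  State (fun _ => 0%R)
    (fun a i => if a == input_array then
                  if i is Posz j then nth 0%R input j else 0%R
                else 0%R).

Definition has_output (st : state) (output : seq int) : Prop :=
  forall j, j < size output -> arr st output_array (Posz j) = nth 0%R output j.

(* [es] lists every edge of [E] exactly once; the order of the list and the
   order of the two endpoints of each edge are arbitrary. *)
Definition lists_edges n (E : {set {set 'I_n}}) (es : seq ('I_n * 'I_n)) : Prop :=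
  perm_eq [seq [set e.1; e.2] | e <- es] (enum E).

Definition encode (I : instance) (es : seq ('I_(nv I) * 'I_(nv I))) : seq int :=
  [:: Posz (nv I); Posz (size es); Posz (src I); Posz (tgt I);
      budget I; bound I]
  ++ flatten [seq [:: Posz e.1; Posz e.2;
                      Posz (len I [set e.1; e.2])]
             | e : 'I_(nv I) * 'I_(nv I) <- es].

Arguments encode : clear implicits.

Definition encode_edge_set n (fs : seq ('I_n * 'I_n)) : seq int :=
  Posz (size fs) :: flatten
    [seq [:: Posz e.1; Posz e.2] | e : 'I_n * 'I_n <- fs].

(* The program and the constant do not depend on the instance.  The feedback edge
   set [F] is part of the input and need not be minimum; the size bounds are
   in terms of its cardinality. *)
Definition has_linear_time_kernel (gV gE : nat -> nat) : Prop :=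
  exists (P : cmd) (C : nat),
  forall (I : instance) (F : {set {set 'I_(nv I)}})
         (es fs : seq ('I_(nv I) * 'I_(nv I))),
    feedback_edge_set (edges I) F ->
    lists_edges (edges I) es ->
    lists_edges F fs ->
    exists (time : nat) (st : state) (I' : instance)
           (es' : seq ('I_(nv I') * 'I_(nv I'))),
      [/\ exec P (init_state (encode I es ++ encode_edge_set fs)) time st,
          time <= C * (nv I + #|edges I|),
          lists_edges (edges I') es' /\ has_output st (encode I' es'),
          (sp_mve I <-> sp_mve I')
        & nv I' <= gV #|F| /\ #|edges I'| <= gE #|F|].

(* Main.v *)
(** By shortest-path duality, deleting at most [k] edges can push the
    [st]-distance up to [l] iff some integer potential [h] with
    [h t - h s >= l] has at most [k] edges [uv] with [|h u - h v| > tau uv]: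
    take [h] to be the (capped) distance from [s], and delete the violated edges.
    In this form reductions are local.  A leaf copies the potential of its
    neighbour, and the potential of a vertex of degree two can be interpolated,
    so that two edges in series amount to one edge of the total length.

    Double all lengths and [l], and split every feedback edge into two equal
    halves; the contractions in the remaining forest then never produce parallel
    edges.  Let [X] consist of [s], [t] and the ends of the feedback edges, so
    that [|X| <= 2f + 2].  Peeling leaves, with [s] kept as a root, drops the
    leaves outside [X] and contracts the other vertices outside [X], except those
    where two branches meet.  Every such vertex uses up two of the chains hanging
    below it, so there are at most [|X| - 2] of them when [|X| >= 2].  This leaves
    at most [4f + 2] vertices and [4f + 1] forest edges, besides the [f] midpoints
    and the [2f] halves.

    No adjacency lists are needed for linear time: the machine stores, for each
    vertex, its degree, the sum of its neighbours and the sum of the lengths of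
    its edges, and for a vertex of degree one the two sums are its neighbour and
    the length of its edge.  A feedback edge [uv] is recognised by a table lookup
    at [n * u + v], the multiples of [n] being computed by repeated addition. *)

Require Import Defs.
From mathcomp Require Import all_boot all_order all_algebra.
From mathcomp Require Import zify.

Set Implicit Arguments.
Unset Strict Implicit.
Unset Printing Implicit Defensive.

Import GRing.Theory Num.Theory Order.TTheory.
Import Defs.

(** * Potentials *)

Section Potentials.
Local Open Scope ring_scope.

Definition violated (T : Type) (h : T -> int) (c : T * T * int) : bool :=
  c.2 < `|h c.1.1 - h c.1.2|.

(** Edges form a list over an arbitrary type, so parallel edges count separately and no finite
    vertex set has to be maintained during the reductions. *)
Definition feasible (T : Type) (cs : seq (T * T * int)) (s t : T) (k l : int) :=
  exists h : T -> int, l <= h t - h s /\ (count (violated h) cs)%:Z <= k.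

Definition touch (T : eqType) (v : T) (c : T * T * int) : bool :=
  (c.1.1 == v) || (c.1.2 == v).

Lemma feasible_perm (T : eqType) (cs cs' : seq (T * T * int)) s t k l :
  perm_eq cs cs' -> feasible cs s t k l <-> feasible cs' s t k l.
Proof.
by move=> /permP cs_cs'; split=> -[h [hl hk]]; exists h; split=> //;
  rewrite ?cs_cs' // -cs_cs'.
Qed.

Lemma feasible_flip (T : Type) (a b : T) (d : int) cs s t k l :
  feasible ((a, b, d) :: cs) s t k l <-> feasible ((b, a, d) :: cs) s t k l.
Proof.
have vC h x y : violated h (x, y, d) = violated (T := T) h (y, x, d).
  by rewrite /violated /= distrC.
by split=> -[h [hl hk]]; exists h; split=> //=; rewrite vC.
Qed.

(** Potentials pull back along [g] and go the other way along [g'], whose values matter only on the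
    image of [K]. This serves to rename vertices. *)
Lemma feasible_map (T : eqType) (T' : Type) (g : T -> T') (g' : T' -> T)
    (K : {pred T}) (cs : seq (T * T * int)) s t k l :
  {in K, cancel g g'} -> s \in K -> t \in K ->
  all (fun c => (c.1.1 \in K) && (c.1.2 \in K)) cs ->
  feasible [seq (g c.1.1, g c.1.2, c.2) | c <- cs] (g s) (g t) k l
    <-> feasible cs s t k l.
Proof.
move=> gK Ks Kt /allP Kcs; split=> -[h [hl hk]].
  by exists (h \o g); split=> //=; move: hk; rewrite count_map.
exists (h \o g'); split; first by rewrite /= !gK.
apply: le_trans hk; rewrite count_map lez_nat.
rewrite (eq_in_count (a2 := violated h)) // => c /Kcs /andP[K1 K2].
by rewrite /violated /= !gK.
Qed.

(** Doubling a potential doubles all differences. Conversely, halves rounded down suffice: if they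
    differ by more than [c.2], the integers differ by more than twice that, and a difference of at
    least [l + l] leaves at least [l]. *)
Lemma feasible_double (T : Type) (cs : seq (T * T * int)) s t k l :
  feasible cs s t k l <->
  feasible [seq (c.1, c.2 + c.2) | c <- cs] s t k (l + l).
Proof.
split=> -[h [hl hk]].
  exists (fun x => h x + h x); split; first by lia.
  apply: le_trans hk; rewrite count_map lez_nat; apply: sub_count => c /=.
  by rewrite /violated /=; lia.
exists (fun x => (h x %/ 2)%Z); split; first by lia.
apply: le_trans hk; rewrite count_map lez_nat; apply: sub_count => c /=.
by rewrite /violated /=; lia.
Qed.

Section Local.
Variables (T : eqType) (s t v : T) (cs : seq (T * T * int)) (k l : int).
Hypotheses (vs : v != s) (vt : v != t) (vcs : all (predC (touch v)) cs).

Let upd (h : T -> int) y x := if x == v then y else h x.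

Let count_upd h y : count (violated (upd h y)) cs = count (violated h) cs.
Proof.
apply: eq_in_count => c /(allP vcs); rewrite /= /touch negb_or => /andP[c1 c2].
by rewrite /violated /upd (negbTE c1) (negbTE c2).
Qed.

Let upd_st h y : upd h y t - upd h y s = h t - h s.
Proof. by rewrite /upd ![_ == v]eq_sym (negbTE vs) (negbTE vt). Qed.

Lemma feasible_leaf (p : T) (d : int) :
  p != v -> 0 <= d ->
  feasible ((v, p, d) :: cs) s t k l <-> feasible cs s t k l.
Proof.
move=> pv d0; split=> -[h [hl hk]].
  by exists h; split=> //; apply: le_trans hk; rewrite lez_nat leq_addl.
exists (upd h (h p)); rewrite upd_st /= count_upd; split=> //.
by rewrite {1}/violated /upd /= eqxx (negbTE pv); move: hk; lia.
Qed.

Lemma feasible_contract (p q : T) (d e : int) :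
  p != v -> q != v -> 0 <= d -> 0 <= e ->
  feasible [:: (v, p, d), (q, v, e) & cs] s t k l
    <-> feasible ((q, p, e + d) :: cs) s t k l.
Proof.
move=> pv qv d0 e0; split=> -[h [hl hk]].
  (* By the triangle inequality, a violated merged edge has a violated part. *)
  by exists h; split=> //; apply: le_trans hk; rewrite /violated /=; lia.
(* If the merged edge is satisfied, [h p] clamped to within [e] of [h q] is still within [d] of
   [h p], so both parts are satisfied. Otherwise [v] copies [p], and only the part at [q] can be
   violated. *)
pose y := if `|h q - h p| <= e + d then
  Num.max (h q - e) (Num.min (h q + e) (h p)) else h p.
exists (upd h y); rewrite upd_st /= count_upd; split=> //.
apply: le_trans hk; rewrite /violated /upd /= eqxx (negbTE pv) (negbTE qv).
by rewrite /y; case: ifP; lia.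
Qed.

End Local.

End Potentials.

(** * Distances from a source, capped at a bound *)

Section ShortestPaths.
Variables (V : finType) (E : {set {set V}}) (w : {set V} -> nat) (s : V).
Local Open Scope nat_scope.

Lemma path_length_cat x p q :
  path_length w x (p ++ q) = path_length w x p + path_length w (last x p) q.
Proof. by rewrite /path_length pairmap_cat sumn_cat. Qed.

(** A path without repetition has fewer than [#|V|] steps, so the search is finite and the predicate
    boolean, as [ex_minn] requires. *)
Let reach (B : nat) (v : V) (j : nat) :=
  (j == B) || [exists n : 'I_#|V|, exists p : n.-tuple V,
     [&& path (adj E) s p, last s p == v, uniq (s :: p) &
         path_length w s p == j]].

Let ex_reach B v : exists j, reach B v j.
Proof. by exists B; rewrite /reach eqxx. Qed.

(* The cap [B] is also the value at vertices that cannot be reached. *)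
Definition capped_dist B v := ex_minn (ex_reach B v).

Lemma capped_dist_le B v p : is_path E s v p -> capped_dist B v <= path_length w s p.
Proof.
move=> [pp lp up]; rewrite /capped_dist; case: ex_minnP => j _; apply.
rewrite /reach; apply/orP; right.
have lt_p : size p < #|V| by move: (max_card (mem (s :: p))); rewrite (card_uniqP up).
apply/existsP; exists (Ordinal lt_p); apply/existsP; exists (in_tuple p).
by rewrite pp lp up !eqxx.
Qed.

Lemma capped_dist_le_cap B v : capped_dist B v <= B.
Proof.
by rewrite /capped_dist; case: ex_minnP => j _; apply; rewrite /reach eqxx.
Qed.

Lemma capped_distP B v : capped_dist B v = B \/
  exists2 p, is_path E s v p & path_length w s p = capped_dist B v.
Proof.
rewrite /capped_dist; case: ex_minnP => j /orP[/eqP->|]; first by left.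
move=> /existsP[n /existsP[p /and4P[pp /eqP lp up /eqP <-]]] _; right.
by exists p.
Qed.

Lemma capped_dist_edge B x y : adj E x y ->
  capped_dist B y <= capped_dist B x + w [set x; y].
Proof.
move=> xy; have [->|[p [pp lp up] <-]] := capped_distP B x.
  exact: leq_trans (capped_dist_le_cap _ _) (leq_addr _ _).
(* If the optimal path to [x] already visits [y], its prefix up to [y] is short enough; otherwise
   the path extends to [y] without repetition. *)
have [y_p|y_p] := boolP (y \in s :: p).
  case/splitPl: y_p pp up {lp} => p1 p2 lp1.
  rewrite cat_path -cat_cons cat_uniq => /andP[pp1 _] /andP[up1 _].
  rewrite path_length_cat -addnA; apply: leq_trans (leq_addr _ _).
  by apply: capped_dist_le.
have -> : path_length w s p + w [set x; y] = path_length w s (rcons p y).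
  by rewrite -cats1 path_length_cat lp /path_length /= addn0.
apply: capped_dist_le; split; rewrite ?last_rcons //.
  by rewrite rcons_path pp lp.
by rewrite -rcons_cons rcons_uniq y_p.
Qed.

End ShortestPaths.

Lemma telescope (V : finType) (E : {set {set V}}) (w : {set V} -> nat) (h : V -> int) x p :
  (forall u v, adj E u v -> (`|h u - h v| <= (w [set u; v])%:Z)%R) ->
  path (adj E) x p -> (h (last x p) - h x <= (path_length w x p)%:Z)%R.
Proof.
move=> hE; elim: p x => [|y p IH] x /=; first by rewrite subrr.
move=> /andP[/hE xy /IH]; rewrite /path_length /=; lia.
Qed.

(** * From instances to potentials and back *)

Lemma sp_mve_feasible (I : instance) (es : seq ('I_(nv I) * 'I_(nv I))) :
  lists_edges (edges I) es ->
  sp_mve I <-> feasible [seq (e.1, e.2, Posz (len I [set e.1; e.2])) | e <- es]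
                 (src I) (tgt I) (budget I) (bound I).
Proof.
(* Violation is stated for unordered edges, since the orientation of the pairs in [es] is arbitrary;
   letting [u] and [v] range over both ends accounts for the absolute value. *)
move=> es_E; pose viol (h : _ -> int) (e : {set 'I_(nv I)}) :=
  [exists u in e, exists v in e, ((len I e)%:Z < h u - h v)%R].
have violE h (u v : 'I_(nv I)) : viol h [set u; v] = ((len I [set u; v])%:Z < `|h u - h v|)%R.
  apply/existsP/idP => [[a /andP[a_e /existsP[b /andP[b_e]]]]|].
    move: a_e b_e; rewrite !inE => /orP[]/eqP-> /orP[]/eqP->; lia.
  case: (leP (h u) (h v)) => uv huv.
    exists v; rewrite !inE eqxx orbT; apply/existsP; exists u; rewrite !inE eqxx /=; lia.
  exists u; rewrite !inE eqxx; apply/existsP; exists v; rewrite !inE eqxx orbT /=; lia.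
have count_viol h : count (violated h)
    [seq (e.1, e.2, Posz (len I [set e.1; e.2])) | e <- es] = #|[set e in edges I | viol h e]|.
  rewrite count_map (eq_count (a2 := preim (fun e => [set e.1; e.2]) (viol h))); last first.
    by move=> e; rewrite /= violE.
  rewrite -(count_map (fun e => [set e.1; e.2])) (permP es_E).
  by rewrite cardE -size_filter /enum_mem -filter_predI; congr (size _); apply: eq_filter => e; rewrite /= !inE andbC.
split.
  move=> [S [S_E S_k S_p]].
  (* A bound that is not positive is met by the zero potential, which violates no edge. *)
  have [b_neg|b_pos] := lerP (bound I) 0.
    exists (fun=> 0%R); rewrite subrr; split=> //; apply: le_trans S_k.
    by rewrite count_map (eq_count (a2 := pred0)) ?count_pred0 // => e; rewrite /violated /=; lia.
  (* With the bound itself as the cap, a target that cannot be reached still gets a large enough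
     potential. *)
  pose B := `|bound I|%N; pose d := capped_dist (edges I :\: S) (len I) (src I) B.
  exists (fun v => Posz (d v)); split.
    have ds : d (src I) <= 0 by apply: (@capped_dist_le _ _ _ _ B _ [::]).
    have : (bound I <= (d (tgt I))%:Z)%R.
      have [|[p /S_p hp]] := capped_distP (edges I :\: S) (len I) (src I) B (tgt I); rewrite -/d.
        by move=> ->; rewrite /B; lia.
      by move=> <-.
    lia.
  (* Across an edge outside [S] the distance changes by at most the length, in both directions;
     hence every violated edge lies in [S]. *)
  apply: le_trans S_k; rewrite count_viol lez_nat; apply/subset_leq_card/subsetP => e.
  rewrite inE => /andP[e_E]; apply: contraTT => eNS.
  have /eqP/cards2P[x [y [xy e_xy]]] := edges_simple e_E; rewrite {}e_xy in e_E eNS *.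
  have xy_ES : adj (edges I :\: S) x y by rewrite /adj inE eNS.
  have yx_ES : adj (edges I :\: S) y x by rewrite /adj setUC.
  have := capped_dist_edge (len I) (src I) B xy_ES.
  have := capped_dist_edge (len I) (src I) B yx_ES.
  rewrite violE [[set y; x]]setUC -/d -leNgt; move: (d x) (d y) (len I _) => *; lia.
(* Conversely the violated edges are deleted; along any remaining path [h] grows by at most the
   length of the path. *)
move=> [h [hl hk]]; exists [set e in edges I | viol h e]; split.
- by apply/subsetP => e; rewrite inE => /andP[].
- by rewrite -count_viol.
move=> p [pp lp _]; apply: le_trans hl _; rewrite -lp.
by apply: telescope pp => u v; rewrite /adj !inE => /andP[] /[swap] -> /=; rewrite violE -leNgt.
Qed.

Lemma kernel_instance N (L : seq ('I_N * 'I_N * int)) (s t : 'I_N) (k l : int) :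
  all (fun c => (c.1.1 != c.1.2) && (0 < c.2)%R) L ->
  uniq [seq [set c.1.1; c.1.2] | c <- L] ->
  exists (I' : instance) (es' : seq ('I_(nv I') * 'I_(nv I'))),
  [/\ nv I' = N, #|edges I'| = size L, lists_edges (edges I') es',
      encode I' es' = [:: Posz N; Posz (size L); Posz s; Posz t; k; l]
        ++ flatten [seq [:: Posz c.1.1; Posz c.1.2; c.2] | c : 'I_N * 'I_N * int <- L]
    & sp_mve I' <-> feasible L s t k l].
Proof.
move=> /allP L_ok uL; set sets := map _ L in uL.
pose E := [set e in sets].
(* The length of an edge is found at its position in [sets], which has no repetition; the default is
   reached only outside [E]. *)
pose w e := `|(nth (s, s, 0%R) L (index e sets)).2|%N.
have E_simple : simple_graph E.
  by move=> e; rewrite inE => /mapP[c /L_ok /andP[cc _] ->]; rewrite cards2 cc.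
have wE c : c \in L -> Posz (w [set c.1.1; c.1.2]) = c.2.
  move=> c_L; rewrite /w -(nth_index (s, s, 0%R) c_L).
  set i := index c L; have i_L : i < size L by rewrite index_mem.
  have -> : [set (nth (s, s, 0%R) L i).1.1; (nth (s, s, 0%R) L i).1.2] = nth set0 sets i.
    by rewrite (nth_map (s, s, 0%R)).
  rewrite index_uniq ?size_map // nth_index //.
  by have /andP[_] := L_ok c c_L; move: c.2 => d; lia.
have w_gt0 e : e \in E -> 0 < w e.
  by rewrite inE => /mapP[c c_L ->]; have /andP[] := L_ok c c_L; rewrite -ltz_nat wE.
pose es := [seq c.1 | c <- L].
have es_E : lists_edges E es.
  rewrite /lists_edges -map_comp; apply: uniq_perm; rewrite ?enum_uniq // => e.
  by rewrite mem_enum inE.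
exists (Instance s t k l E_simple w_gt0), es; split=> //.
- by rewrite cardsE (card_uniqP uL) size_map.
- rewrite /encode /= size_map -map_comp; congr [:: _, _, _, _, _, _ & flatten _].
  by apply/eq_in_map => c c_L /=; rewrite wE.
have := @sp_mve_feasible (Instance s t k l E_simple w_gt0) es es_E; rewrite /= -map_comp.
rewrite [map _ L](_ : _ = L) //; rewrite -[RHS]map_id; apply/eq_in_map => c c_L /=.
by rewrite wE //; case: c {c_L} => [[]].
Qed.

(* A longest path from [s], or from any vertex if [s] is isolated, could only
   stop by closing a cycle. *)
Lemma acyclic_edgeless (V : finType) (e : rel V) (s : V) :
  symmetric e -> irreflexive e ->
  (forall c, ucycle e c -> size c < 3) ->
  (forall w u, w != s -> e w u -> exists2 z, e w z & z != u) ->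
  forall x y, ~~ e x y.
Proof.
move=> eC e_irr acyc branch x y; apply/negP => xy.
(* Paths of every length contradict finiteness. The last disjunct keeps the head [w] different from
   [s], so that [branch] applies to it: either [s] lies further back on the path or [s] has no
   neighbour. *)
suff long n : exists w u q, [/\ size q = n, uniq [:: w, u & q], path e w (u :: q)
    & (s \in u :: q) || ~~ [exists z, e s z]].
  have [w [u [q [sz_q uq _ _]]]] := long #|V|.
  by have := max_card (mem [:: w, u & q]); rewrite (card_uniqP uq) /= sz_q ltnNge leqW.
elim: n => [|n [w [u [q [sz_q uq pq s_q]]]]].
  have [/existsP[z sz]|no_z] := boolP [exists z, e s z].
    exists z, s, [::]; split; rewrite /= ?inE ?eqxx ?andbT ?[e z s]eC //.
    by apply: contraTneq sz => ->; rewrite e_irr.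
  exists x, y, [::]; split; rewrite /= ?andbT ?xy ?no_z ?orbT // inE.
  by apply: contraTneq xy => ->; rewrite e_irr.
have wu : e w u by case/andP: pq.
have ws : w != s.
  case/orP: s_q => [s_q|]; last by apply: contraNneq => <-; apply/existsP; exists u.
  by apply: contraTneq uq => ->; rewrite cons_uniq s_q.
have [z wz zu] := branch w u ws wu.
have zw : z != w by apply: contraTneq wz => ->; rewrite e_irr.
have [z_q|z_q] := boolP (z \in q); last first.
  exists z, w, (u :: q); split; rewrite /= ?sz_q ?[e z w]eC ?wz //.
  - by rewrite !inE (negbTE zw) (negbTE zu) (negbTE z_q) /=; exact: uq.
  - by case/orP: s_q => [s_q|->]; rewrite ?orbT // inE s_q orbT.
(* The new neighbour lies on the path beyond [u], which closes a cycle through at least three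
   vertices. *)
case/splitPr: z_q uq pq {s_q sz_q} => q1 q2 uq pq.
have /acyc : ucycle e [:: w, u & rcons q1 z].
  apply/andP; split.
    rewrite /cycle rcons_path last_cons last_rcons [e z w]eC wz andbT.
    by move: pq; rewrite /= -cat_rcons cat_path andbA => /andP[].
  by move: uq; rewrite -cat_rcons -!cat_cons cat_uniq => /andP[].
by rewrite /= size_rcons.
Qed.

(** * The machine and the program *)

Section Machine.

Fixpoint loopfree (c : cmd) : bool :=
  match c with
  | Seq c1 c2 | If _ c1 c2 => loopfree c1 && loopfree c2
  | While _ _ => false
  | _ => true
  end.

(** A functional semantics for loop-free commands, so that loop bodies can be evaluated by
    computation. The value at [While] is a placeholder. *)
Fixpoint run (c : cmd) (st : state) : state :=
  match c with
  | Skip | While _ _ => st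
  | Assign x e => set_var st x (eval st e)
  | Put a i e => set_arr st a (eval st i) (eval st e)
  | Seq c1 c2 => run c2 (run c1 st)
  | If b c1 c2 => if holds st b then run c1 st else run c2 st
  end.

Lemma run_seq c1 c2 st : run (Seq c1 c2) st = run c2 (run c1 st).
Proof. by []. Qed.

Lemma run_if_eq e1 e2 c1 c2 st :
  run (If (Eq e1 e2) c1 c2) st = if eval st e1 == eval st e2 then run c1 st else run c2 st.
Proof. by []. Qed.

Fixpoint max_cost (c : cmd) : nat :=
  match c with
  | Skip | While _ _ => 1
  | Assign x e => (expr_cost e).+1
  | Put a i e => (expr_cost i + expr_cost e).+1
  | Seq c1 c2 => max_cost c1 + max_cost c2
  | If b c1 c2 => test_cost b + maxn (max_cost c1) (max_cost c2)
  end.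

Lemma exec_run c st : loopfree c ->
  exists2 n, n <= max_cost c & exec c st n (run c st).
Proof.
elim: c st => [|x e|a i e|c1 IH1 c2 IH2|b c1 IH1 c2 IH2|//] st /=.
- by exists 1; last exact: ExecSkip.
- by eexists; last exact: ExecAssign.
- by eexists; last exact: ExecPut.
- move=> /andP[lf1 lf2].
  have [n1 n1_le ex1] := IH1 st lf1; have [n2 n2_le ex2] := IH2 (run c1 st) lf2.
  by exists (n1 + n2); [exact: leq_add | exact: ExecSeq ex1 ex2].
move=> /andP[lf1 lf2].
have [n1 n1_le ex1] := IH1 st lf1; have [n2 n2_le ex2] := IH2 st lf2.
case: ifP => [hb|/negbT hb].
  by exists (test_cost b + n1); [rewrite leq_add2l leq_max n1_le | exact: ExecIfTrue].
by exists (test_cost b + n2); [rewrite leq_add2l leq_max n2_le orbT | exact: ExecIfFalse].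
Qed.

(** The measure [m] is a parameter of the invariant and not a function of the state, because the
    peeling loop is measured by the edges that remain in the forest, and no variable stores their
    number. *)
Lemma exec_while b c (inv : nat -> state -> Prop) :
  loopfree c ->
  (forall m st, inv m st -> holds st b -> exists2 m', m' < m & inv m' (run c st)) ->
  forall m st, inv m st ->
  exists n m' st', [/\ exec (While b c) st n st',
    n <= (test_cost b + max_cost c) * m + test_cost b, inv m' st' & ~~ holds st' b].
Proof.
move=> lf step m; have [N] := ubnP m; elim: N m => // N IH m m_N st inv_st.
have [hb|hb] := boolP (holds st b); last first.
  by exists (test_cost b), m, st; split=> //; [exact: ExecWhileFalse | exact: leq_addl].
have [m1 m1_lt inv1] := step m st inv_st hb.
have [n1 n1_le ex1] := exec_run st lf.
have [|n2 [m2 [st' [ex2 n2_le inv_end end_b]]]] := IH m1 _ (run c st) inv1.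
  exact: leq_trans m1_lt _.
exists (test_cost b + n1 + n2), m2, st'; split=> //; first exact: ExecWhileTrue ex1 ex2.
apply: leq_trans (leq_add (leq_add (leqnn _) n1_le) n2_le) _.
by rewrite addnA -mulnS leq_add2r leq_mul2l m1_lt orbT.
Qed.

Lemma exec_while_measure b c (inv : state -> Prop) (mu : state -> nat) :
  loopfree c ->
  (forall st, inv st -> holds st b -> inv (run c st) /\ mu (run c st) < mu st) ->
  forall st, inv st ->
  exists n st', [/\ exec (While b c) st n st',
    n <= (test_cost b + max_cost c) * mu st + test_cost b, inv st' & ~~ holds st' b].
Proof.
move=> lf step st inv_st.
have [//|m st1 [inv1 ->] hb||n [m [st' [ex n_le [inv' _] ends]]]] :=
  @exec_while b c (fun m st => inv st /\ m = mu st) _ _ (mu st) st.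
- by have [inv2 lt2] := step _ inv1 hb; exists (mu (run c st1)).
- by split.
by exists n, st'.
Qed.

End Machine.

(** * The kernelization program *)

Local Notation x_n := 0.
Local Notation x_m := 1.
Local Notation x_s := 2.
Local Notation x_t := 3.
Local Notation x_i := 4.
Local Notation x_f := 5.
Local Notation x_u := 6.
Local Notation x_v := 7.
Local Notation x_l := 8.
Local Notation x_keys := 9.
Local Notation x_out := 10.
Local Notation x_p := 11.
Local Notation x_r := 12.

(* [a_id] holds [0] at vertices that are not kept, and otherwise one plus the new
   name of the vertex.  [a_deg], [a_nbr] and [a_len] are the three sums that
   replace adjacency lists; [a_deg] is too large by 2 at [s], so that [s] is
   never peeled.  A vertex [w] that is not kept may have one pending chain below
   it, which is represented by an edge from the kept vertex [a_from w] to [w] of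
   length [a_dist w]; there is none iff [a_dist w = 0]. *)
Local Notation a_in := 0.
Local Notation a_out := 1.
Local Notation a_mul := 2.
Local Notation a_id := 3.
Local Notation a_fes := 4.
Local Notation a_deg := 5.
Local Notation a_nbr := 6.
Local Notation a_len := 7.
Local Notation a_from := 8.
Local Notation a_dist := 9.

Local Notation "c1 ;; c2" := (Seq c1 c2) (at level 60, right associativity).
Local Notation "# z" := (Cst (Posz z)) (at level 2, format "# z").

Definition triple (e : expr) : expr := Add e (Add e e).
Definition incr (x : nat) : cmd := Assign x (Add (Var x) #1).
Definition add_at (a : nat) (i e : expr) : cmd := Put a i (Add (Get a i) e).
Definition sub_at (a : nat) (i e : expr) : cmd := Put a i (Sub (Get a i) e).

Definition mark (e : expr) : cmd :=
  If (Eq (Get a_id e) #0) (incr x_keys ;; Put a_id e (Var x_keys)) Skip.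

(** Each edge takes three output cells after the six cells of the header. The stored names are
    shifted by one, hence the subtractions. *)
Definition emit (a b d : expr) : cmd :=
  Put a_out (Add #6 (triple (Var x_out))) (Sub (Get a_id a) #1) ;;
  Put a_out (Add #7 (triple (Var x_out))) (Sub (Get a_id b) #1) ;;
  Put a_out (Add #8 (triple (Var x_out))) d ;;
  incr x_out.

Definition read_header : cmd :=
  Assign x_n (Get a_in #0) ;; Assign x_m (Get a_in #1) ;;
  Assign x_s (Get a_in #2) ;; Assign x_t (Get a_in #3).

Definition mul_test : test := Le (Add (Var x_i) #1) (Var x_n).
Definition mul_body : cmd :=
  Put a_mul (Add (Var x_i) #1) (Add (Get a_mul (Var x_i)) (Var x_n)) ;; incr x_i.

Definition start_keys : cmd :=
  mark (Var x_s) ;; mark (Var x_t) ;; Put a_deg (Var x_s) #2 ;;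
  Assign x_f (Get a_in (Add #6 (triple (Var x_m)))) ;; Assign x_i #0.

Definition fes_test : test := Le (Add (Var x_i) #1) (Var x_f).
Definition fes_body : cmd :=
  Assign x_u (Get a_in (Add (Add #7 (triple (Var x_m))) (Add (Var x_i) (Var x_i)))) ;;
  Assign x_v (Get a_in (Add (Add #8 (triple (Var x_m))) (Add (Var x_i) (Var x_i)))) ;;
  mark (Var x_u) ;; mark (Var x_v) ;;
  Put a_fes (Add (Get a_mul (Var x_u)) (Var x_v)) #1 ;; incr x_i.

Definition link : cmd :=
  add_at a_deg (Var x_u) #1 ;; add_at a_deg (Var x_v) #1 ;;
  add_at a_nbr (Var x_u) (Var x_v) ;; add_at a_nbr (Var x_v) (Var x_u) ;;
  add_at a_len (Var x_u) (Add (Var x_l) (Var x_l)) ;;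
  add_at a_len (Var x_v) (Add (Var x_l) (Var x_l)).

(** The midpoint of input edge number [i] is called [n + i], a name that no original vertex has. *)
Definition subdivide : cmd :=
  incr x_keys ;; Put a_id (Add (Var x_n) (Var x_i)) (Var x_keys) ;;
  emit (Var x_u) (Add (Var x_n) (Var x_i)) (Var x_l) ;;
  emit (Add (Var x_n) (Var x_i)) (Var x_v) (Var x_l).

Definition edge_test : test := Le (Add (Var x_i) #1) (Var x_m).
Definition edge_body : cmd :=
  Assign x_u (Get a_in (Add #6 (triple (Var x_i)))) ;;
  Assign x_v (Get a_in (Add #7 (triple (Var x_i)))) ;;
  Assign x_l (Get a_in (Add #8 (triple (Var x_i)))) ;;
  If (Eq (Add (Get a_fes (Add (Get a_mul (Var x_u)) (Var x_v)))
              (Get a_fes (Add (Get a_mul (Var x_v)) (Var x_u)))) #0)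
     link subdivide ;;
  incr x_i.

Definition start_peel : cmd := Assign x_i #0 ;; Assign x_v #0.

Definition unlink : cmd :=
  Assign x_p (Get a_nbr (Var x_v)) ;; Assign x_l (Get a_len (Var x_v)) ;;
  Put a_deg (Var x_v) #0 ;; Put a_nbr (Var x_v) #0 ;; Put a_len (Var x_v) #0 ;;
  sub_at a_deg (Var x_p) #1 ;; sub_at a_nbr (Var x_p) (Var x_v) ;;
  sub_at a_len (Var x_p) (Var x_l).

(* Ends with [x_l = 0] when the peeled vertex [x_v] is a leaf to be dropped. *)
Definition select : cmd :=
  If (Eq (Get a_id (Var x_v)) #0)
    (If (Eq (Get a_dist (Var x_v)) #0)
       (Assign x_l #0)
       (Assign x_r (Get a_from (Var x_v)) ;;
        Assign x_l (Add (Get a_dist (Var x_v)) (Var x_l)) ;;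
        Put a_dist (Var x_v) #0))
    (Assign x_r (Var x_v)).

(** The chain from [x_r] arrives at [x_p]. If [x_p] is kept, the chain becomes an edge; if no chain
    is pending there, it waits; if one is pending, two branches meet, so [x_p] becomes kept and both
    chains become edges. *)
Definition attach : cmd :=
  If (Eq (Get a_id (Var x_p)) #0)
    (If (Eq (Get a_dist (Var x_p)) #0)
       (Put a_from (Var x_p) (Var x_r) ;; Put a_dist (Var x_p) (Var x_l))
       (incr x_keys ;; Put a_id (Var x_p) (Var x_keys) ;;
        emit (Get a_from (Var x_p)) (Var x_p) (Get a_dist (Var x_p)) ;;
        emit (Var x_r) (Var x_p) (Var x_l) ;;
        Put a_dist (Var x_p) #0))
    (emit (Var x_r) (Var x_p) (Var x_l)).

Definition peel_test : test := Le (Add (Var x_i) #1) (Var x_n).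
Definition peel_body : cmd :=
  If (Eq (Get a_deg (Var x_v)) #1)
    (unlink ;; select ;; If (Eq (Var x_l) #0) Skip attach ;; Assign x_v (Var x_p))
    (incr x_i ;; Assign x_v (Var x_i)).

(** Forest lengths are doubled and each half of a feedback edge carries its full original length, so
    the bound is doubled while the budget is copied. *)
Definition write_header : cmd :=
  Put a_out #0 (Var x_keys) ;; Put a_out #1 (Var x_out) ;;
  Put a_out #2 (Sub (Get a_id (Var x_s)) #1) ;;
  Put a_out #3 (Sub (Get a_id (Var x_t)) #1) ;;
  Put a_out #4 (Get a_in #4) ;;
  Put a_out #5 (Add (Get a_in #5) (Get a_in #5)).

Definition kernel_program : cmd :=
  read_header ;; While mul_test mul_body ;;
  start_keys ;; While fes_test fes_body ;;
  Assign x_i #0 ;; While edge_test edge_body ;;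
  start_peel ;; While peel_test peel_body ;;
  write_header.

(** * Correctness of the program *)

Local Open Scope ring_scope.

Local Notation edge := (int * int * int)%type.

Definition edge0 : edge := (Posz 0, Posz 0, Posz 0).

(* Equal to [index], but over [int] only: [lia] does not identify occurrences of
   [index] at different canonical structures on [int]. *)
Definition pos (K : seq int) (x : int) : nat := index x K.

(** * Sums over the neighbours of a vertex *)

(** An incident edge contributes [g] of its other end and its length. Three choices of [g] yield the
    degree, the sum of the neighbours and the sum of the lengths. *)
Definition nbsum (g : int -> int -> int) (T : seq edge) (x : int) : int :=
  \sum_(c <- T) ((c.1.1 == x)%:Z * g c.1.2 c.2 + (c.1.2 == x)%:Z * g c.1.1 c.2).

Lemma nbsum_nil g x : nbsum g [::] x = 0.
Proof. exact: big_nil. Qed.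

Lemma nbsum_cons g c T x :
  nbsum g (c :: T) x
    = (c.1.1 == x)%:Z * g c.1.2 c.2 + (c.1.2 == x)%:Z * g c.1.1 c.2 + nbsum g T x.
Proof. exact: big_cons. Qed.

Lemma nbsum_perm g T T' x : perm_eq T T' -> nbsum g T x = nbsum g T' x.
Proof. by move=> TT'; apply: perm_big. Qed.

Lemma nbsum_rcons g c T x :
  nbsum g (rcons T c) x
    = (c.1.1 == x)%:Z * g c.1.2 c.2 + (c.1.2 == x)%:Z * g c.1.1 c.2 + nbsum g T x.
Proof. by rewrite -nbsum_cons; apply: nbsum_perm; rewrite perm_rcons. Qed.

Lemma nbsum_untouched g T x : all (predC (touch x)) T -> nbsum g T x = 0.
Proof.
elim: T => [|c T IH] /=; first by rewrite nbsum_nil.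
rewrite nbsum_cons /touch negb_or => /andP[/andP[/negbTE-> /negbTE->] /IH->].
by rewrite !mul0r.
Qed.

Lemma nbsum1_ge0 T x : 0 <= nbsum (fun _ _ => 1) T x.
Proof. by apply: sumr_ge0 => c _; lia. Qed.

Lemma nbsum1_eq0 T x : nbsum (fun _ _ => 1) T x = 0 -> all (predC (touch x)) T.
Proof.
elim: T => [//|c T IH]; rewrite nbsum_cons => e0 /=; have := nbsum1_ge0 T x.
by move=> ge0; rewrite IH /touch /=; move: e0 ge0; rewrite /= ; lia.
Qed.

Lemma nbsum1_eq1 T v :
  all (fun c => c.1.1 != c.1.2) T -> nbsum (fun _ _ => 1) T v = 1 ->
  exists p d c T', [/\ p != v, c = (v, p, d) \/ c = (p, v, d), perm_eq T (c :: T')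
    & all (predC (touch v)) T'].
Proof.
move=> Tl T1; have [c c_T cv] : exists2 c, c \in T & touch v c.
  apply/hasP; apply: contra_eqT T1; rewrite -all_predC => vT.
  by rewrite nbsum_untouched.
have ab := allP Tl c c_T; have pT := perm_to_rem c_T.
move: T1; rewrite (nbsum_perm _ _ pT) nbsum_cons.
move: (rem c T) pT => T' pT T1; case: c cv ab pT T1 {c_T} => [[a b] d].
rewrite /touch /= => /orP[]/eqP-> ab pT T1.
  exists b, d, (v, b, d), T'; split; [by rewrite eq_sym | by left | by [] |].
  by apply: nbsum1_eq0; move: T1 ab; lia.
exists a, d, (a, v, d), T'; split; [by [] | by right | by [] |].
by apply: nbsum1_eq0; move: T1 ab; lia.
Qed.

(** * Kept vertices and emitted edges *)

Definition good_edge (c : edge) : bool := (c.1.1 != c.1.2) && (0 < c.2).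

Definition same_ends (c c' : edge) : bool :=
  (c.1 == c'.1) || (c.1 == (c'.1.2, c'.1.1)).

Definition simple_edges (L : seq edge) : bool :=
  pairwise (fun c c' => ~~ same_ends c c') L.

Lemma simple_edges_rcons L c :
  simple_edges (rcons L c) = simple_edges L && all (fun c' => ~~ same_ends c' c) L.
Proof.
by rewrite /simple_edges -cats1 pairwise_cat allrel1r /= andbT andbC.
Qed.

(** The list [K] is ordered by new names: the name of a kept vertex is its position. *)
Definition keys_ok (st : state) (K : seq int) : Prop :=
  [/\ uniq K, var st x_keys = (size K)%:Z
    & forall x, arr st a_id x = if x \in K then (pos K x).+1%:Z else 0].

Lemma keys_ok_id st K x : keys_ok st K -> (arr st a_id x == 0) = (x \notin K).
Proof. by move=> [_ _ ->]; case: (x \in K). Qed.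

Lemma keys_ok_rcons st st' K x :
  keys_ok st K -> x \notin K -> var st' x_keys = (size K)%:Z + 1 ->
  (forall y, arr st' a_id y = if y == x then (size K)%:Z + 1 else arr st a_id y) ->
  keys_ok st' (rcons K x).
Proof.
move=> [uK sK idK] x_K s' id'; split; rewrite ?rcons_uniq ?x_K ?uK //.
  by rewrite size_rcons s'; lia.
move=> y; rewrite id' mem_rcons inE /pos -cats1 index_cat; case: eqVneq => [->|yx] /=.
  by rewrite (negbTE x_K) eqxx addn0; lia.
by rewrite idK; case: ifP.
Qed.

Lemma keys_ok_frame st st' K :
  keys_ok st K -> var st' x_keys = var st x_keys -> arr st' a_id =1 arr st a_id ->
  keys_ok st' K.
Proof. by move=> [uK sK idK] sE idE; split; rewrite ?sE // => x; rewrite idE. Qed.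

Definition out_ok (st : state) (K : seq int) (L : seq edge) : Prop :=
  var st x_out = (size L)%:Z /\
  forall j : nat, (j < size L)%N -> let c := nth edge0 L j in
  [/\ arr st a_out (6 + (j%:Z + (j%:Z + j%:Z))) = pos K c.1.1,
      arr st a_out (7 + (j%:Z + (j%:Z + j%:Z))) = pos K c.1.2
    & arr st a_out (8 + (j%:Z + (j%:Z + j%:Z))) = c.2].

Lemma out_ok_frame st st' K L :
  out_ok st K L -> var st' x_out = var st x_out -> arr st' a_out =1 arr st a_out ->
  out_ok st' K L.
Proof. by move=> [sL oL] sE oE; split; rewrite ?sE // => j /oL; rewrite !oE. Qed.

Definition ends_in (K : seq int) (c : edge) : bool := (c.1.1 \in K) && (c.1.2 \in K).

(** Keys are only appended, so the names already written for edges between old keys stay valid. *)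
Lemma out_ok_rcons_key st K L x :
  all (ends_in K) L -> out_ok st K L -> out_ok st (rcons K x) L.
Proof.
move=> /allP LK [sL oL]; split=> // j jL; rewrite /=; have [-> -> ->] := oL j jL.
have /andP[K1 K2] := LK _ (mem_nth edge0 jL).
by rewrite /pos -cats1 !index_cat K1 K2.
Qed.

(** The operands [eb] and [ed] are evaluated after earlier writes to the output, so their values are
    required to survive such writes. *)
Lemma run_emit st ea eb ed K L a b d :
  keys_ok st K -> out_ok st K L -> a \in K -> b \in K ->
  eval st ea = a -> (forall x y, eval (set_arr st a_out x y) eb = b) ->
  (forall x y x' y', eval (set_arr (set_arr st a_out x y) a_out x' y') ed = d) ->
  let st' := run (emit ea eb ed) st in
  [/\ out_ok st' K (rcons L (a, b, d)),
      forall x, x != x_out -> var st' x = var st x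
    & forall c, c != a_out -> arr st' c =1 arr st c].
Proof.
move=> [uK sK idK] [sL oL] aK bK ea_a eb_b ed_d /=.
rewrite ea_a eb_b ed_d !idK aK bK /=; split; last 1 first.
- by move=> c c_out x /=; rewrite (negbTE c_out).
- split=> /=; first by rewrite size_rcons sL; lia.
  move=> j; rewrite size_rcons ltnS leq_eqVlt nth_rcons sL => /orP[/eqP->|jL].
    rewrite ltnn eqxx /=; split; do ?case: eqP => //=; lia.
  rewrite jL; have [<- <- <-] := oL j jL.
  by split; do ?case: eqP => //=; lia.
by move=> x x_out /=; rewrite (negbTE x_out).
Qed.

Definition add_key (K : seq int) (x : int) : seq int := if x \in K then K else rcons K x.

Lemma mem_add_key K x y : (y \in add_key K x) = (y == x) || (y \in K).
Proof.
rewrite /add_key; case: ifPn => x_K; last by rewrite mem_rcons inE.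
by case: eqVneq => // ->; rewrite x_K.
Qed.

Lemma size_add_key K x : (size (add_key K x) <= (size K).+1)%N.
Proof. by rewrite /add_key; case: ifP => _; rewrite ?size_rcons. Qed.

Lemma run_mark st e K x :
  keys_ok st K -> eval st e = x -> (forall z, eval (set_var st x_keys z) e = x) ->
  let st' := run (mark e) st in
  [/\ keys_ok st' (add_key K x),
      forall y, y != x_keys -> var st' y = var st y
    & forall c, c != a_id -> arr st' c =1 arr st c].
Proof.
move=> okK e_x e_x' /=; rewrite e_x (keys_ok_id _ okK); rewrite /add_key; case: ifPn => [x_K|].
  rewrite (negbTE x_K); split=> /=.
  - apply: (keys_ok_rcons okK x_K) => /=; have [_ sK _] := okK; first by rewrite sK.
    by move=> y; rewrite e_x' sK.
  - by move=> y /negbTE->.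
  - by move=> c /negbTE c_id y; rewrite c_id.
by rewrite negbK => ->.
Qed.

(** * Multiplication table and table of feedback edges *)

Definition in_segment (n : nat) (x : int) : bool := (0 <= x) && (x < n%:Z).

Definition listed (Fl : seq (int * int)) (c : edge) : bool :=
  (c.1 \in Fl) || ((c.1.2, c.1.1) \in Fl).

Definition double (c : edge) : edge := (c.1, c.2 + c.2).

Definition forest_edges (Fl : seq (int * int)) (E : seq edge) : seq edge :=
  [seq double c | c <- E & ~~ listed Fl c].

Section Kernel.
Variables (n : nat) (s t k l : int) (E : seq edge) (Fl : seq (int * int)).
Variable A0 : int -> int.

Local Notation in_range := (in_segment n).
Local Notation in_fes := (listed Fl).
Local Notation forest := (forest_edges Fl E).

Hypotheses (s_n : in_range s) (t_n : in_range t).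
Hypothesis E_ok : all (fun c : edge => [&& in_range c.1.1, in_range c.1.2, c.1.1 != c.1.2 & 0 < c.2]) E.
Hypothesis Fl_n : all (fun e => in_range e.1 && in_range e.2) Fl.
Hypothesis count_Fl : count in_fes E = size Fl.
Hypothesis forest_uniq : uniq forest.
(** The form in which acyclicity is used: a nonempty part of the forest has a vertex of degree one
    other than [s], so peeling cannot get stuck. *)
Hypothesis forest_peelable : forall T : seq edge, uniq T -> {subset T <= forest} ->
  (forall v, in_range v -> v != s -> nbsum (fun _ _ => 1) T v != 1) -> T = [::].

Hypothesis A0_header :
  [/\ A0 0 = n%:Z, A0 1 = (size E)%:Z, A0 2 = s & [/\ A0 3 = t, A0 4 = k & A0 5 = l]].
Hypothesis A0_edge : forall j : nat, (j < size E)%N -> let c := nth edge0 E j in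
  [/\ A0 (6 + (j%:Z + (j%:Z + j%:Z))) = c.1.1,
      A0 (7 + (j%:Z + (j%:Z + j%:Z))) = c.1.2
    & A0 (8 + (j%:Z + (j%:Z + j%:Z))) = c.2].
Hypothesis A0_size_Fl : A0 (6 + ((size E)%:Z + ((size E)%:Z + (size E)%:Z))) = (size Fl)%:Z.
Hypothesis A0_Fl : forall j : nat, (j < size Fl)%N -> let e := nth edge0.1 Fl j in
  A0 (7 + ((size E)%:Z + ((size E)%:Z + (size E)%:Z)) + (j%:Z + j%:Z)) = e.1
  /\ A0 (8 + ((size E)%:Z + ((size E)%:Z + (size E)%:Z)) + (j%:Z + j%:Z)) = e.2.

Definition base st :=
  [/\ var st x_n = n%:Z, var st x_m = (size E)%:Z, var st x_s = s, var st x_t = t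
    & arr st a_in =1 A0].

Definition mul_ok st := forall x, in_range x -> arr st a_mul x = n%:Z * x.

Definition inv_mul st := base st /\ exists i : nat,
  [/\ (i <= n)%N, var st x_i = i%:Z,
      forall x, (0 <= x) && (x <= i%:Z) -> arr st a_mul x = n%:Z * x
    & [/\ forall a x, (2 < a)%N -> arr st a x = 0, var st x_keys = 0 & var st x_out = 0]].

Lemma exec_mul st0 : arr st0 a_in =1 A0 -> (forall x, var st0 x = 0) ->
  (forall a x, (0 < a)%N -> arr st0 a x = 0) ->
  exists N st, [/\ exec (While mul_test mul_body) (run read_header st0) N st,
    (N <= 100 * n + 100)%N, base st, mul_ok st
  & [/\ forall a x, (2 < a)%N -> arr st a x = 0, var st x_keys = 0 & var st x_out = 0]].
Proof.
move=> in0 var0 arr0; have [h0 h1 h2 [h3 h4 h5]] := A0_header.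
have [//|st||N [st [ex N_le [base_st [i [i_n st_i mul_i rest]]] ends]]] :=
  @exec_while_measure mul_test mul_body inv_mul (fun st => `|n%:Z - var st x_i|%N) _ _ (run read_header st0).
- move=> [[hn hm hs ht hin] [i [i_n hi mul_i [rest hk ho]]]] /=; rewrite hi hn => i_lt.
  split; last by lia.
  split; first by split.
  exists i.+1; split=> //=; [by lia | by lia | | split=> //].
  + move=> x x_i; case: eqP => [->|x_ne]; rewrite mul_i; lia.
  + by move=> a x a2 /=; case: eqP => [a_2|_]; [lia | exact: rest].
- split; first by split=> //=; rewrite !in0 ?h0 ?h1 ?h2 ?h3.
  exists 0%N; split=> //=; rewrite ?var0 //.
    by move=> x; rewrite arr0; lia.
  by split=> //= a x a2; rewrite arr0; lia.
exists N, st; split=> //.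
  by apply: leq_trans N_le _; rewrite /= var0; lia.
have [hn _ _ _ _] := base_st.
move: ends; rewrite /= st_i hn => ends x x_n; apply: mul_i; move: x_n; rewrite /in_range; lia.
Qed.

Definition fes_ok (fl : seq (int * int)) (st : state) :=
  forall x, arr st a_fes x = (x \in [seq n%:Z * e.1 + e.2 | e <- fl])%:Z.

Definition keyed (K : seq int) (e : int * int) := (e.1 \in K) && (e.2 \in K).

(** The bound [2 * i + 2] counts [s], [t] and two ends for each feedback edge read. *)
Definition inv_fes st := [/\ base st, mul_ok st & exists (i : nat) (K : seq int),
  [/\ [/\ (i <= size Fl)%N, var st x_i = i%:Z, var st x_f = (size Fl)%:Z & var st x_out = 0],
      [/\ keys_ok st K, all in_range K, s \in K, t \in K & (size K <= 2 * i + 2)%N],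
      all (keyed K) (take i Fl) /\ fes_ok (take i Fl) st
    & (forall x, arr st a_deg x = 2 * (x == s)%:Z)
      /\ forall a x, (5 < a)%N -> arr st a x = 0]].

Lemma base_frame st st' : base st ->
  (forall x, (x < 4)%N -> var st' x = var st x) -> arr st' a_in =1 arr st a_in ->
  base st'.
Proof.
by move=> [hn hm hs ht hin] hv ha; split; rewrite ?hv // => x; rewrite ha.
Qed.

Lemma mul_ok_frame st st' : mul_ok st -> arr st' a_mul =1 arr st a_mul -> mul_ok st'.
Proof. by move=> mul_st e x x_n; rewrite e mul_st. Qed.

Lemma start_inv_fes st : base st -> mul_ok st ->
  (forall a x, (2 < a)%N -> arr st a x = 0) -> var st x_keys = 0 -> var st x_out = 0 ->
  inv_fes (run start_keys st).
Proof.
move=> base_st mul_st arr0 keys0 out0; have [hn hm hs ht hin] := base_st.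
have ok0 : keys_ok st [::] by split=> // x; rewrite arr0.
have [] := run_mark ok0 (e := Var x_s) erefl (fun _ => erefl).
set st1 := run _ st => ok1 v1 a1.
have [] := run_mark ok1 (e := Var x_t) erefl (fun _ => erefl).
set st2 := run _ st1 => ok2 v2 a2.
have v x : x != x_keys -> var st2 x = var st x by move=> xk; rewrite v2 // v1.
have a c : c != a_id -> arr st2 c =1 arr st c by move=> ca x; rewrite a2 // a1.
rewrite /= v1 // hs ht in ok2.
have -> : run start_keys st = run (Put a_deg (Var x_s) #2 ;;
  Assign x_f (Get a_in (Add #6 (triple (Var x_m)))) ;; Assign x_i #0) st2 by [].
split.
- by apply: base_frame base_st _ _ => x => [x4|] /=; rewrite ?a // -v; case: x x4 => [|[|[|[]]]].
- by apply: mul_ok_frame mul_st _ => x /=; rewrite a.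
exists 0%N, (add_key (add_key [::] s) t); split.
- by split=> //=; rewrite ?v // a // hm hin A0_size_Fl.
- split=> //; try by rewrite !mem_add_key eqxx ?orbT.
  + by apply/allP => x; rewrite !mem_add_key => /or3P[/eqP->|/eqP->|].
  + by rewrite (leq_trans (size_add_key _ _)) // ltnS (size_add_key [::]).
- by split=> [|x]; rewrite take0 //= a ?arr0.
split=> [x|c x c5] /=.
  by rewrite v // hs a ?arr0 //; case: eqP.
case: eqP => [c_5|_] /=; first by move: c5; rewrite c_5.
by rewrite a ?arr0 //; move: c5; clear; lia.
Qed.

Lemma exec_fes st0 : inv_fes st0 -> var st0 x_i = 0 ->
  exists N st K, [/\ exec (While fes_test fes_body) st0 N st,
    (N <= 100 * size Fl + 100)%N, base st, mul_ok st
  & [/\ [/\ keys_ok st K, all in_range K, s \in K, t \in K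
          & (size K <= 2 * size Fl + 2)%N],
      all (keyed K) Fl, fes_ok Fl st, var st x_out = 0
    & (forall x, arr st a_deg x = 2 * (x == s)%:Z)
      /\ forall a x, (5 < a)%N -> arr st a x = 0]].
Proof.
move=> inv0 i0.
have [//|st|//|N [st [ex N_le [base_st mul_st inv_st] ends]]] :=
  @exec_while_measure fes_test fes_body inv_fes (fun st => `|(size Fl)%:Z - var st x_i|%N) _ _ st0.
  move=> [base_st mul_st [i [K [[i_f hi hf ho] [okK K_n sK tK K_le] [keyed_i fes_i] [deg_i arr0]]]]] i_lt.
  have {}i_lt : (i < size Fl)%N by move: i_lt; rewrite /= hi hf; clear; lia.
  have [hn hm hs ht hin] := base_st; have [u_i v_i] := A0_Fl i_lt.
  set e := nth _ Fl i in u_i v_i.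
  have /andP[u_n v_n] : in_range e.1 && in_range e.2 := allP Fl_n _ (mem_nth _ i_lt).
  set st1 := set_var (set_var st x_u e.1) x_v e.2.
  have ok1 : keys_ok st1 K by apply: keys_ok_frame okK _ _.
  have [] := run_mark ok1 (e := Var x_u) erefl (fun _ => erefl).
  set st2 := run _ st1 => ok2 v2 a2.
  have [] := run_mark ok2 (e := Var x_v) erefl (fun _ => erefl).
  set st3 := run _ st2 => ok3 v3 a3.
  have v x : x != x_keys -> var st3 x = var st1 x by move=> xk; rewrite v3 // v2.
  have a c : c != a_id -> arr st3 c =1 arr st c by move=> ca x; rewrite a3 // a2.
  rewrite /= v2 //= in ok3.
  have -> : run fes_body st = run (Put a_fes (Add (Get a_mul (Var x_u)) (Var x_v)) #1 ;; incr x_i) st3.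
    by rewrite /st3 /st2 /st1 -u_i -v_i -hm -hi -!hin.
  set st4 := run _ st3.
  have vi : var st4 x_i = i.+1%:Z by rewrite /= v //= hi; clear; lia.
  split; last by rewrite vi hi; move: i_lt; clear; lia.
  split.
  - by apply: base_frame base_st _ _ => x; rewrite /st4 /= ?a //; case: x => [|[|[|[|x]]]] //= _; rewrite v.
  - by apply: mul_ok_frame mul_st _ => x; rewrite /st4 /= a.
  exists i.+1, (add_key (add_key K e.1) e.2); split.
  - by split=> //=; rewrite ?v.
  - split; try by rewrite !mem_add_key ?sK ?tK ?orbT.
    + by apply: keys_ok_frame ok3 _ _ => //= x.
    + by apply/allP => x; rewrite !mem_add_key => /or3P[/eqP->|/eqP->|/(allP K_n)].
    + have := size_add_key K e.1; have := size_add_key (add_key K e.1) e.2; move: K_le; clear; lia.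
  - rewrite (take_nth edge0.1) // all_rcons /keyed !mem_add_key !eqxx ?orbT /=; split.
      apply/allP => e' /(allP keyed_i) /andP[K1 K2].
      by rewrite !mem_add_key K1 K2 !orbT.
    move=> x; rewrite /= !v //= !a // mul_st // map_rcons mem_rcons inE -/e.
    by case: eqP => //= _; rewrite a.
  split=> [x|c x c5] /=; first by rewrite a.
  case: eqP => [c_4|_] /=; first by move: c5; rewrite c_4.
  by rewrite a ?arr0 //; move: c5; clear; lia.
have [i [K [[i_f hi hf ho] [okK K_n sK tK K_le] [keyed_i fes_i] rest]]] := inv_st.
have i_eq : i = size Fl by move: ends; rewrite /= hi hf; move: i_f; clear; lia.
rewrite i_eq take_size in keyed_i fes_i K_le.
exists N, st, K; split=> //.
by apply: leq_trans N_le _; rewrite /= i0; clear; lia.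
Qed.

(** * Splitting the feedback edges and recording the forest *)

Definition sums_ok (T : seq edge) (st : state) : Prop :=
  [/\ forall x, arr st a_deg x = nbsum (fun _ _ => 1) T x + 2 * (x == s)%:Z,
      forall x, arr st a_nbr x = nbsum (fun y _ => y) T x
    & forall x, arr st a_len x = nbsum (fun _ d => d) T x].

(** For [y] below [n], the number [n * x + y] has the digits [x] and [y] in base [n], so distinct
    pairs use distinct cells. *)
Lemma fes_ok_mem st x y : fes_ok Fl st -> in_range x -> in_range y ->
  arr st a_fes (n%:Z * x + y) = ((x, y) \in Fl)%:Z.
Proof.
rewrite /in_range => fes x_n y_n; rewrite fes; congr (_%:Z); congr (nat_of_bool _).
apply/mapP/idP => [[[a b] ab_F /= e]|xy_F]; last by exists (x, y).
have := allP Fl_n _ ab_F; rewrite /in_range /= => ab_n.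
have x_a : x = a.
  have n_ge0 : 0 <= n%:Z by [].
  have lt_n u v : u < v -> n%:Z * u + n%:Z <= n%:Z * v.
    by move=> uv; rewrite -{2}[n%:Z]mulr1 -mulrDr ler_wpM2l //; move: uv; clear; lia.
  by case: (ltgtP x a) => // /lt_n; move: e ab_n y_n; clear; lia.
by have -> : y = b; [move: e; rewrite x_a; clear; lia | rewrite x_a].
Qed.

Definition forest_upto i := [seq double c | c <- take i E & ~~ in_fes c].

(** [D] lists the midpoints created so far and [L] the halves. Unread edges, recorded forest edges
    and halves together stay equivalent to the input. That each half has an end at or above [n]
    later shows that no forest edge is parallel to it. *)
Definition inv_edge (KX : seq int) (st : state) :=
  [/\ base st, mul_ok st, fes_ok Fl st
  & exists (i : nat) (D : seq int) (L : seq edge),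
  [/\ [/\ (i <= size E)%N, var st x_i = i%:Z, sums_ok (forest_upto i) st
         & forall a x, (7 < a)%N -> arr st a x = 0],
      [/\ keys_ok st (KX ++ D), size D = count in_fes (take i E)
        & all (fun x : int => (n%:Z <= x) && (x < n%:Z + i%:Z)) D],
      [/\ out_ok st (KX ++ D) L, size L = (2 * size D)%N, simple_edges L,
          all (ends_in (KX ++ D)) L
        & all (fun c : edge => ((n%:Z <= c.1.1) || (n%:Z <= c.1.2)) && good_edge c) L]
    & feasible ([seq double c | c <- drop i E] ++ forest_upto i ++ L) s t k (l + l)
        <-> feasible E s t k l]].

Lemma inv_edge_step KX st : all in_range KX -> s \in KX -> t \in KX ->
  all (keyed KX) Fl -> inv_edge KX st -> holds st edge_test ->
  inv_edge KX (run edge_body st) /\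
  (`|(size E)%:Z - var (run edge_body st) x_i| < `|(size E)%:Z - var st x_i|)%N.
Proof.
move=> KX_n sKX tKX keyedF [base_st mul_st fes_st].
move=> [i [D [L [[i_E hi sums_i arr0] [okK sD D_n] [okL sL simpL L_K L_ok] feas]]]] i_lt.
have [hn hm hs ht hin] := base_st.
have {}i_lt : (i < size E)%N by move: i_lt; rewrite /= hi hm; clear; lia.
have [u_i v_i l_i] := A0_edge i_lt; set c := nth _ E i in u_i v_i l_i.
have c_E : c \in E := mem_nth _ i_lt.
have /and4P[u_n v_n uv l_gt0] := allP E_ok c c_E.
set st1 := set_var (set_var (set_var st x_u c.1.1) x_v c.1.2) x_l c.2.
have -> : run edge_body st = run (incr x_i)
    (if in_fes c then run subdivide st1 else run link st1).
  rewrite /edge_body; set body := If _ _ _.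
  have -> : run (Assign x_u (Get a_in (Add #6 (triple (Var x_i)))) ;;
    Assign x_v (Get a_in (Add #7 (triple (Var x_i)))) ;;
    Assign x_l (Get a_in (Add #8 (triple (Var x_i)))) ;; body ;; incr x_i) st
    = run (incr x_i) (run body st1).
    by rewrite /st1 -u_i -v_i -l_i -hi -!hin.
  congr (run _ _); rewrite /body [LHS]/= !mul_st // !fes_ok_mem //.
  rewrite /in_fes [c.1]surjective_pairing /=.
  by do 2!case: (_ \in Fl).
have drop_i : drop i E = c :: drop i.+1 E by rewrite (drop_nth edge0).
have take_i : take i.+1 E = rcons (take i E) c by rewrite (take_nth edge0).
have [c_F|c_F] := boolP (in_fes c); last first.
  set st2 := run _ _.
  have T_i : forest_upto i.+1 = rcons (forest_upto i) (double c).
    by rewrite /forest_upto take_i filter_rcons c_F map_rcons.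
  have vi : var st2 x_i = i.+1%:Z by rewrite /= hi; clear; lia.
  split; last by rewrite vi hi; move: i_lt; clear; lia.
  split.
  - by apply: base_frame base_st _ _ => x; rewrite /st2 //=; case: x => [|[|[|[|x]]]].
  - exact: mul_ok_frame mul_st _.
  - by move=> x; rewrite /st2 /=; exact: fes_st.
  exists i.+1, D, L; split.
  - have [dg nb ln] := sums_i; split=> //; last first.
      move=> a x a7; have aE b : (b <= 7)%N -> (a == b) = false by move: a7; clear; lia.
      rewrite /st2 /= !aE //=. exact: arr0.
    have vu : (c.1.2 == c.1.1) = false by rewrite eq_sym; apply/negbTE.
    split=> x; rewrite T_i nbsum_rcons /st2 /= ?dg ?nb ?ln !(eq_sym _ x) vu;
      (case: (eqVneq x c.1.2) => [->|_];
        [rewrite vu | case: (eqVneq x c.1.1) => [->|_]]); clear; lia.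
  - split=> //; first by rewrite take_i -cats1 count_cat /= (negbTE c_F) !addn0.
    by apply: sub_all D_n => x; clear; lia.
  - by split.
  rewrite -feas; apply: feasible_perm; apply/permP => p.
  by rewrite T_i drop_i -cats1 !count_cat /= addn0; clear; lia.
(* The new midpoint exceeds every key so far. *)
set z : int := n%:Z + i%:Z; set K := KX ++ rcons D z.
have z_notin x : x \in KX ++ D -> x < z.
  rewrite mem_cat => /orP[/(allP KX_n)|/(allP D_n)] /=; rewrite /in_range /z; clear; lia.
have K_E : K = rcons (KX ++ D) z by rewrite rcons_cat.
have z_new : z \notin KX ++ D by apply/negP => /z_notin; rewrite ltxx.
set st2 := run (incr x_keys ;; Put a_id (Add (Var x_n) (Var x_i)) (Var x_keys)) st1.
have [_ keys_size _] := okK.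
have ok2 : keys_ok st2 K.
  rewrite K_E; apply: keys_ok_rcons okK z_new _ _ => [|y] /=; rewrite keys_size //.
  by rewrite hn hi.
have out2 : out_ok st2 K L.
  by rewrite K_E; apply: out_ok_rcons_key => //; apply: out_ok_frame okL _ _.
have [uF vF] : c.1.1 \in KX /\ c.1.2 \in KX.
  by case/orP: c_F => /(allP keyedF) /andP[].
have zK : z \in K by rewrite K_E mem_rcons mem_head.
have inK x : x \in KX -> x \in K by rewrite mem_cat => ->.
have eval_z st' : var st' x_n = n%:Z -> var st' x_i = i%:Z ->
    eval st' (Add (Var x_n) (Var x_i)) = z.
  by rewrite /= => -> ->.
have [//|x y|//|] := run_emit (ea := Var x_u) (eb := Add (Var x_n) (Var x_i))
  (ed := Var x_l) (a := c.1.1) (b := z) (d := c.2) ok2 out2 (inK _ uF) zK.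
  exact: eval_z.
set st3 := run _ st2 => out3 v3 a3.
have ok3 : keys_ok st3 K by apply: keys_ok_frame ok2 _ _; [exact: v3 | exact: a3].
have [|x y|x y x' y'|] := run_emit (ea := Add (Var x_n) (Var x_i)) (eb := Var x_v)
  (ed := Var x_l) (a := z) (b := c.1.2) (d := c.2) ok3 out3 zK (inK _ vF).
- by apply: eval_z; rewrite v3.
- exact: v3.
- exact: v3.
set st4 := run _ st3 => out4 v4 a4.
have -> : run subdivide st1 = st4 by [].
have v x : x != x_out -> var st4 x = var st2 x by move=> xk; rewrite v4 // v3.
have a b : b != a_out -> arr st4 b =1 arr st2 b by move=> ba x; rewrite a4 // a3.
clearbody st4; set st5 := run _ _.
have vi : var st5 x_i = i.+1%:Z by rewrite /st5 /= v //= hi; clear; lia.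
split; last by rewrite vi hi; move: i_lt; clear; lia.
have T_i : forest_upto i.+1 = forest_upto i.
  by rewrite /forest_upto take_i filter_rcons c_F.
split.
- by apply: base_frame base_st _ _ => x; rewrite /st5 /= ?a //; case: x => [|[|[|[|x]]]] //= _; rewrite v.
- by apply: mul_ok_frame mul_st _ => x; rewrite /st5 /= a.
- by move=> x; rewrite /st5 /= a //=; exact: fes_st.
exists i.+1, (rcons D z), (rcons (rcons L (c.1.1, z, c.2)) (z, c.1.2, c.2)).
have L_z e : e \in L -> (e.1.1 < z) && (e.1.2 < z).
  by move=> /(allP L_K) /andP[/z_notin-> /z_notin->].
have lt_z x : in_range x -> x < z by rewrite /in_range /z; clear; lia.
split.
- split=> //; first by have [dg nb ln] := sums_i; split=> x; rewrite T_i /st5 /= a //; [exact: dg | exact: nb | exact: ln].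
  move=> b x b7; have bE c' : (c' <= 7)%N -> (b == c') = false by move: b7; clear; lia.
  by rewrite /st5 /= a ?bE //= bE //=; exact: arr0.
- split=> //; first by apply: keys_ok_frame ok2 _ _ => [|x]; rewrite /st5 /= ?v ?a.
    by rewrite size_rcons take_i -cats1 count_cat /= c_F sD; clear; lia.
  rewrite all_rcons; apply/andP; split; first by rewrite /z; clear; lia.
  by apply: sub_all D_n => x; clear; lia.
- split=> //; first by rewrite !size_rcons sL; clear; lia.
  + have := lt_z _ u_n; have := lt_z _ v_n; move: uv simpL L_z => uv simpL L_z v_z u_z.
    rewrite !simple_edges_rcons simpL all_rcons /=; apply/and3P; split.
    * apply/allP => -[[x y] d] /L_z; rewrite /same_ends /= !xpair_eqE; clear; lia.
    * by rewrite /same_ends /= !xpair_eqE; move: uv u_z; clear; lia.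
    * apply/allP => -[[x y] d] /L_z; rewrite /same_ends /= !xpair_eqE; clear; lia.
  + rewrite !all_rcons /ends_in /= zK !inK //=; apply: sub_all L_K => e /andP[].
    by rewrite /ends_in -/K K_E !mem_rcons !inE => -> ->; rewrite !orbT.
  + rewrite !all_rcons L_ok /good_edge l_gt0 /= andbT.
    by move: (lt_z _ u_n) (lt_z _ v_n); rewrite /z; clear; lia.
rewrite -feas T_i drop_i /=.
set A := map double _; set T := forest_upto i.
have touchless : all (predC (touch z)) (A ++ T ++ L).
  apply/allP => e e_ALT /=; suff /andP[lt1 lt2] : (e.1.1 < z) && (e.1.2 < z) by rewrite /touch !lt_eqF.
  move: e_ALT; rewrite !mem_cat => /or3P[/mapP[e' /mem_drop e'_E ->]|/mapP[e'] |/L_z //].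
    by have /and4P[/lt_z-> /lt_z-> _ _] := allP E_ok _ e'_E.
  rewrite mem_filter => /andP[_ /mem_take e'_E ->].
  by have /and4P[/lt_z-> /lt_z-> _ _] := allP E_ok _ e'_E.
have z_ne x : in_range x -> x != z by move=> /lt_z; clear; lia.
rewrite (_ : double c = (c.1.1, c.1.2, c.2 + c.2)); last by rewrite /double [c.1]surjective_pairing.
have [zs zt] : z != s /\ z != t by rewrite ![z == _]eq_sym !z_ne.
(* The doubled feedback edge is the contraction of its two halves at the fresh vertex [z]. *)
rewrite -(feasible_contract k (l + l) zs zt touchless (z_ne _ v_n) (z_ne _ u_n) (ltW l_gt0) (ltW l_gt0)).
apply: feasible_perm; apply/permP => p; rewrite -!cats1 !count_cat /= !count_cat.
by clear; lia.
Qed.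

Lemma exec_edge KX st0 : all in_range KX -> s \in KX -> t \in KX -> all (keyed KX) Fl ->
  base st0 -> mul_ok st0 -> fes_ok Fl st0 -> keys_ok st0 KX ->
  var st0 x_i = 0 -> var st0 x_out = 0 ->
  (forall x, arr st0 a_deg x = 2 * (x == s)%:Z) ->
  (forall a x, (5 < a)%N -> arr st0 a x = 0) ->
  exists N st D L, [/\ exec (While edge_test edge_body) st0 N st,
    (N <= 200 * size E + 200)%N, base st,
    [/\ keys_ok st (KX ++ D), size D = size Fl, all (fun x : int => n%:Z <= x) D,
        sums_ok forest st & forall a x, (7 < a)%N -> arr st a x = 0]
  & [/\ [/\ out_ok st (KX ++ D) L, size L = (2 * size Fl)%N, simple_edges L,
          all (ends_in (KX ++ D)) L
        & all (fun c : edge => ((n%:Z <= c.1.1) || (n%:Z <= c.1.2)) && good_edge c) L]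
    & feasible (forest ++ L) s t k (l + l) <-> feasible E s t k l]].
Proof.
move=> KX_n sKX tKX keyedF base0 mul0 fes0 ok0 i0 out0 deg0 arr0.
have [//|st||N [st [ex N_le [base_st mul_st fes_st inv_st] ends]]] :=
  @exec_while_measure edge_test edge_body (inv_edge KX) (fun st => `|(size E)%:Z - var st x_i|%N) _ _ st0.
- exact: inv_edge_step.
- split=> //; exists 0%N, [::], [::]; rewrite cats0 drop0 /forest_upto take0 /=.
  split=> //; last by rewrite cats0 -feasible_double.
    split=> //; last by move=> a x a7; apply: arr0; move: a7; clear; lia.
    by split=> x; rewrite nbsum_nil ?deg0 ?arr0 // add0r.
have [i [D [L [[i_E hi sums_i arr_st] [okK sD D_n] [okL sL simpL L_K L_ok] feas]]]] := inv_st.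
have [_ hm _ _ _] := base_st.
have i_eq : i = size E by move: ends; rewrite /= hi hm; move: i_E; clear; lia.
rewrite i_eq take_size count_Fl in sD; rewrite /forest_upto i_eq take_size in sums_i.
rewrite /forest_upto i_eq take_size drop_size /= in feas.
exists N, st, D, L; split=> //.
- by apply: leq_trans N_le _; rewrite /= i0; clear; lia.
- by split=> //; apply: sub_all D_n => x /andP[].
by split=> //; split=> //; rewrite -sD.
Qed.

(** * Peeling the forest *)

Lemma forest_ok c : c \in forest ->
  [/\ in_range c.1.1, in_range c.1.2, c.1.1 != c.1.2 & 0 < c.2].
Proof.
move=> /mapP[e]; rewrite mem_filter => /andP[_ /(allP E_ok) /and4P[e1 e2 ne e_gt0]] ->.
by split=> //; rewrite /double /=; move: e_gt0; clear; lia.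
Qed.

Lemma run_unlink st T v : sums_ok T st -> {subset T <= forest} ->
  var st x_v = v -> arr st a_deg v = 1 ->
  let st' := run unlink st in
  exists p d c T',
  [/\ [/\ in_range v, in_range p, p != v, v != s & 0 < d],
      perm_eq T (c :: T'), c = (v, p, d) \/ c = (p, v, d), all (predC (touch v)) T'
    & [/\ sums_ok T' st', var st' x_p = p & var st' x_l = d]].
Proof.
move=> [dg nb ln] T_forest hv deg_v st'.
(* The offset makes the stored degree of [s] at least 2. *)
have vs : v != s.
  apply: contra_eq_neq deg_v => ->; rewrite dg eqxx; have := nbsum1_ge0 T s; clear; lia.
have nb1 : nbsum (fun _ _ => 1) T v = 1.
  by move: deg_v; rewrite dg (negbTE vs); clear; lia.
have [|p [d [c [T' [pv c_v pT vT']]]]] := nbsum1_eq1 _ nb1.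
  by apply/allP => c /T_forest /forest_ok[].
have c_T : c \in T by rewrite (perm_mem pT) mem_head.
have vp : (v == p) = false by rewrite eq_sym; apply/negbTE.
have pv' : (p == v) = false by apply/negbTE.
have sumE g x : nbsum g T x = (x == v)%:Z * g p d + (x == p)%:Z * g v d + nbsum g T' x.
  rewrite (nbsum_perm _ _ pT) nbsum_cons; case: c_v => -> /=; rewrite ![_ == x]eq_sym //.
  by congr (_ + _); rewrite addrC.
have sum_v g : nbsum g T' v = 0 by apply: nbsum_untouched.
have nbr_v : arr st a_nbr v = p by rewrite nb sumE eqxx vp sum_v; clear; lia.
have len_v : arr st a_len v = d by rewrite ln sumE eqxx vp sum_v; clear; lia.
exists p, d, c, T'; split=> //.
  by have [] := forest_ok (T_forest _ c_T); case: c_v => -> /= ? ? ? ?; split.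
split; last by rewrite /st' /= hv.
  split=> x; rewrite /st' /= hv nbr_v ?len_v ?dg ?nb ?ln !sumE;
    (case: (eqVneq x p) => [->|_]; [rewrite pv' ?eqxx | case: (eqVneq x v) => [->|_]]);
    rewrite ?sum_v ?(negbTE vs) //=; clear; lia.
by rewrite /st' /= hv.
Qed.

(* [KX] and [D] list the ends of the feedback edges (with [s] and [t]) and the
   midpoints, in the order of their new names; [L0] lists the halves. *)
Section Peel.
Variables (KX D : seq int) (L0 : seq edge).
Hypotheses (KX_n : all in_range KX) (sKX : s \in KX) (tKX : t \in KX).
Hypothesis D_n : all (fun x : int => n%:Z <= x) D.
Hypothesis L0_K : all (ends_in (KX ++ D)) L0.
Hypothesis L0_ok :
  all (fun c : edge => ((n%:Z <= c.1.1) || (n%:Z <= c.1.2)) && good_edge c) L0.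

Definition pend (st : state) (W : seq int) : seq edge :=
  [seq (arr st a_from w, w, arr st a_dist w) | w <- W].

Definition starts (L : seq edge) : seq int := [seq c.1.1 | c <- L].

(* [T] is the forest that remains, [W] the vertices with a pending chain, [B] the
   meeting points found so far, [O] the edges emitted for the forest, and [X] holds
   the edge being moved, if any.  Every kept vertex starts at most one edge, after
   it has been peeled; hence there are no parallel edges, and the number of edges
   is bounded.  Without the disjunction on sizes one would only get
   [size B < size KX] in the end, one vertex too many for the bound. *)
Definition core (st : state) (T : seq edge) (W B : seq int) (O X : seq edge) : Prop :=
  [/\ [/\ keys_ok st ((KX ++ D) ++ B), all in_range (KX ++ B)
        & out_ok st ((KX ++ D) ++ B) (L0 ++ O)],
      [/\ uniq W, forall w, (w \in W) = (arr st a_dist w != 0),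
          all (fun w => in_range w && (w \notin KX ++ B)) W
        & all (fun w => 0 < arr st a_dist w) W],
      [/\ simple_edges (L0 ++ O), all (ends_in (KX ++ B)) O & all good_edge O],
      [/\ uniq (starts (O ++ pend st W)), s \notin starts (O ++ pend st W),
          {subset starts (O ++ pend st W) <= KX ++ B}
        & forall r, r \in starts (O ++ pend st W) -> all (predC (touch r)) T]
    & [/\ (2 * size B <= size O)%N,
          [|| 2 * size B < size O, size KX <= 1 | size O + 2 <= size KX + size B]%N
        & feasible (X ++ T ++ pend st W ++ L0 ++ O) s t k (l + l) <-> feasible E s t k l]].

Lemma core_frame st st' T W B O X : core st T W B O X ->
  (var st' x_keys = var st x_keys) -> (var st' x_out = var st x_out) ->
  (arr st' a_id =1 arr st a_id) -> (arr st' a_out =1 arr st a_out) ->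
  (arr st' a_from =1 arr st a_from) -> (arr st' a_dist =1 arr st a_dist) ->
  core st' T W B O X.
Proof.
move=> [[okK K_n okL] [uW W_dist W_n W_gt0] L_ok R_ok [pot1 pot2 feas]] vk vo ai ao af ad.
have pE : pend st' W = pend st W by apply: eq_map => w; rewrite af ad.
split; rewrite ?pE //.
  by split=> //; [exact: keys_ok_frame okK _ _ | exact: out_ok_frame okL _ _].
by split=> // [w|]; [rewrite ad | apply: sub_all W_gt0 => w; rewrite ad].
Qed.

Lemma key_in_range B x : in_range x -> (x \in (KX ++ D) ++ B) = (x \in KX ++ B).
Proof.
move=> x_n; rewrite !mem_cat; case xD : (x \in D); last by rewrite orbF.
by have := allP D_n _ xD; move: x_n; rewrite /in_range /=; clear; lia.
Qed.

Lemma nonkey_untouched B O x : in_range x -> x \notin KX ++ B ->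
  all (ends_in (KX ++ B)) O -> all (predC (touch x)) (L0 ++ O).
Proof.
move=> x_n x_new O_K; rewrite all_cat; apply/andP; split; apply/allP => c.
  move=> /(allP L0_K) /andP[c1 c2]; rewrite /= /touch negb_or.
  have x_KD : x \notin KX ++ D.
    by move: x_new; rewrite -(key_in_range _ x_n) mem_cat negb_or => /andP[].
  by apply/andP; split; apply: contraNneq x_KD => <-.
move=> /(allP O_K) /andP[c1 c2]; rewrite /= /touch negb_or.
by apply/andP; split; apply: contraNneq x_new => <-.
Qed.

Lemma pend_untouched st B W x : x \notin KX ++ B ->
  {subset starts (pend st W) <= KX ++ B} -> x \notin W -> all (predC (touch x)) (pend st W).
Proof.
move=> x_new W_K x_W; apply/allP => c c_W; rewrite /= /touch negb_or; apply/andP; split.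
  by apply: contraNneq x_new => <-; apply: W_K; apply: map_f.
by case/mapP: c_W => w w_W -> /=; apply: contraNneq x_W => <-.
Qed.

(** What [select] hands over to [attach]: the edge from [r] to [p] is in transit, and [r] is kept,
    no longer touches the forest and starts no edge yet, so this edge may become the one that it
    starts. *)
Definition attachable (st : state) T W B O (r p : int) (d : int) : Prop :=
  [/\ core st T W B O [:: (r, p, d)],
      [/\ r \in KX ++ B, r != s, r \notin starts (O ++ pend st W) & all (predC (touch r)) T]
    & [/\ p \notin starts (O ++ pend st W), p != r, in_range p & 0 < d]].

(** If [v] is kept, its edge moves on unchanged. Otherwise [v] is a leaf and is dropped when no
    chain is pending there, and has degree two and is contracted when one is. Lengths are positive,
    so the value 0 of [x_l] is free to signal a dropped leaf. *)
Lemma run_select st T W B O v p d :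
  core st T W B O [:: (v, p, d)] -> var st x_v = v -> var st x_l = d ->
  [/\ in_range v, in_range p, p != v, v != s & 0 < d] ->
  all (predC (touch v)) T ->
  v \notin starts (O ++ pend st W) -> p \notin starts (O ++ pend st W) ->
  let st' := run select st in
  (var st' x_l = 0 /\ core st' T W B O [::]) \/
  exists W' r d', [/\ var st' x_l = d', var st' x_r = r & attachable st' T W' B O r p d'].
Proof.
move=> core_st hv hd [v_n p_n pv vs d_gt0] vT v_R p_R /=.
have [[okK K_n okL] [uW W_dist W_n W_gt0] [simpL O_K O_ok] [uR s_R R_K R_T] [pot1 pot2 feas]] := core_st.
rewrite hv (keys_ok_id _ okK) key_in_range //; case: ifPn => [v_K|]; last first.
  rewrite negbK => v_K; right; exists W, v, d; split=> //; split=> //.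

have vt : v != t by apply: contraNneq v_K => ->; rewrite mem_cat tKX.
have v_L := nonkey_untouched v_n v_K O_K.
have W_K : {subset starts (pend st W) <= KX ++ B}.
  by move=> x x_W; apply: R_K; rewrite /starts map_cat mem_cat x_W orbT.
case: eqVneq => [d0|d_ne0].
  left; split=> //=; split=> //; split=> //.
  have v_W : v \notin W by rewrite W_dist d0 eqxx.
  rewrite -feas; apply: iff_sym; apply: (feasible_leaf _ _ vs vt _ pv (ltW d_gt0)).
  by rewrite !all_cat vT -all_cat (pend_untouched v_K).
have v_W : v \in W by rewrite W_dist.
right; set r := arr st a_from v; set e := arr st a_dist v; set st' := set_arr _ _ _ _.
exists (rem v W), r, (e + d).
have pW := perm_to_rem v_W.
have v_W' : v \notin rem v W by rewrite mem_rem_uniqF.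
have pE : pend st' (rem v W) = pend st (rem v W).
  by apply/eq_in_map => w w_W'; rewrite /st' /=; case: eqP w_W' v_W' => // -> ->.
have pend_perm : perm_eq (pend st W) ((r, v, e) :: pend st (rem v W)) := perm_map _ pW.
have R_perm : perm_eq (starts (O ++ pend st W)) (r :: starts (O ++ pend st (rem v W))).
  apply: (@perm_map _ _ _ _ ((r, v, e) :: (O ++ pend st (rem v W)))); apply/permP => a.
  by rewrite /= !count_cat (permP pend_perm) /=; clear; lia.
have mem_R := perm_mem R_perm; have r_R : r \in starts (O ++ pend st W) by rewrite mem_R mem_head.
have e_gt0 : 0 < e := allP W_gt0 _ v_W.
have r_K := R_K _ r_R.
move: (uR); rewrite (perm_uniq R_perm) /= => /andP[r_R' uR'].
have R'_R x : x \in starts (O ++ pend st (rem v W)) -> x \in starts (O ++ pend st W).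
  by rewrite mem_R inE => ->; rewrite orbT.
split=> //=; first by rewrite hd.
split; rewrite ?pE.
- split=> //; rewrite ?pE.
  + split; first exact: rem_uniq.
    * move=> w; rewrite mem_rem_uniq // inE W_dist /=; by case: eqP.
    * by apply/allP => w /mem_rem /(allP W_n).
    * apply/allP => w w_W' /=; case: eqP w_W' v_W' => [-> -> //|_ /mem_rem w_W _].
      exact: (allP W_gt0).
  + split=> // [|x /R'_R /R_K //|x /R'_R /R_T //].
    by apply: contra s_R => /R'_R.
  split=> //; rewrite -feas; have v_W'L : all (predC (touch v)) (T ++ pend st (rem v W) ++ L0 ++ O).
    rewrite all_cat vT /= all_cat v_L andbT (pend_untouched v_K) // => x x_W'.
    by apply: W_K; rewrite /starts (perm_mem (perm_map _ pend_perm)) inE; apply/orP; right.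
  have rv : r != v by apply: contraNneq v_K => <-.
  rewrite -(feasible_contract _ _ vs vt v_W'L pv rv (ltW d_gt0) (ltW e_gt0)).
  apply: feasible_perm; apply/permP => a; rewrite /= !count_cat (permP pend_perm) /=; clear; lia.
- split=> //; last exact: R_T.
  by apply: contraNneq s_R => <-.
split=> //; last by move: d_gt0 e_gt0; clear; lia.
  by apply: contra p_R => /R'_R.
by apply: contraNneq p_R => ->.
Qed.

(** A half has an end outside the range of [r] and [p], and an edge of [O] starts at neither of
    them, so the new edge is parallel to none. *)
Lemma simple_emit O r p d : simple_edges (L0 ++ O) -> in_range r -> in_range p ->
  r \notin starts O -> p \notin starts O -> simple_edges (L0 ++ rcons O (r, p, d)).
Proof.
move=> simpL r_n p_n r_O p_O; rewrite -rcons_cat simple_edges_rcons simpL all_cat /=.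
apply/andP; split; apply/allP => -[[x y] e].
  move=> /(allP L0_ok) /andP[/= xy_n _]; rewrite /same_ends /= !xpair_eqE.
  by move: r_n p_n xy_n; rewrite /in_range; clear; lia.
move=> /(map_f (fun c : edge => c.1.1)) /= x_O; rewrite /same_ends /= !xpair_eqE.
have [xr xp] : x != r /\ x != p by split; [apply: contraNneq r_O | apply: contraNneq p_O] => <-.
by rewrite (negbTE xr) (negbTE xp).
Qed.

Lemma attach_key st T W B O r p d :
  attachable st T W B O r p d -> p \in KX ++ B ->
  var st x_r = r -> var st x_p = p -> var st x_l = d ->
  core (run (emit (Var x_r) (Var x_p) (Var x_l)) st) T W B (rcons O (r, p, d)) [::].
Proof.
move=> [core_st [r_K rs r_R rT] [p_R pr p_n d_gt0]] p_K hr hp hd.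
have [[okK K_n okL] [uW W_dist W_n W_gt0] [simpL O_K O_ok] [uR s_R R_K R_T] [pot1 pot2 feas]] := core_st.
have r_n : in_range r := allP K_n _ r_K.
have [r_K' p_K'] : r \in (KX ++ D) ++ B /\ p \in (KX ++ D) ++ B by rewrite !key_in_range.
have [//|//|] := run_emit (ea := Var x_r) (eb := Var x_p) (ed := Var x_l) (d := d)
  okK okL r_K' p_K' hr.
set st' := run _ st => out' v a.
have pE : pend st' W = pend st W by apply: eq_map => w; rewrite !a.
have R_perm : perm_eq (starts (rcons O (r, p, d) ++ pend st W)) (r :: starts (O ++ pend st W)).
  apply: (@perm_map _ _ _ _ ((r, p, d) :: (O ++ pend st W))); apply/permP => b.
  by rewrite /= -cats1 !count_cat /=; clear; lia.
have mem_R := perm_mem R_perm.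
have [r_O p_O] : r \notin starts O /\ p \notin starts O.
  by move: r_R p_R; rewrite /starts !map_cat !mem_cat !negb_or => /andP[-> _] /andP[-> _].
split; rewrite ?pE.
- by split=> //; rewrite -rcons_cat.
- by [].
- by split; rewrite ?all_rcons /good_edge /= ?[r == p]eq_sym ?pr ?d_gt0 ?O_ok //= ?simple_emit // /ends_in /= r_K p_K.
- split.
  + by rewrite (perm_uniq R_perm) /= r_R.
  + by rewrite mem_R inE negb_or eq_sym rs.
  + by move=> x; rewrite mem_R inE => /orP[/eqP->|/R_K].
  by move=> x; rewrite mem_R inE => /orP[/eqP->|/R_T].
(* An edge added without a new meeting point makes [2 * size B <= size O] strict, which is the first
   alternative. *)
split; rewrite ?size_rcons; [by move: pot1; clear; lia | by move: pot1; clear; lia |].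
rewrite -feas; apply: feasible_perm; apply/permP => b.
by rewrite -cats1 /= !count_cat /=; clear; lia.
Qed.

Lemma attach_pending st T W B O r p d :
  attachable st T W B O r p d -> p \notin KX ++ B -> arr st a_dist p = 0 ->
  core (set_arr (set_arr st a_from p r) a_dist p d) T (p :: W) B O [::].
Proof.
move=> [core_st [r_K rs r_R rT] [p_R pr p_n d_gt0]] p_K dist_p; set st' := set_arr _ _ _ _.
have [[okK K_n okL] [uW W_dist W_n W_gt0] [simpL O_K O_ok] [uR s_R R_K R_T] [pot1 pot2 feas]] := core_st.
have p_W : p \notin W by rewrite W_dist dist_p.
have d_ne0 : d != 0 by move: d_gt0; clear; lia.
have pE : pend st' (p :: W) = (r, p, d) :: pend st W.
  rewrite /pend /= !eqxx; congr (_ :: _); apply/eq_in_map => w w_W.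
  by case: eqP w_W p_W => // -> ->.
have R_perm : perm_eq (starts (O ++ (r, p, d) :: pend st W)) (r :: starts (O ++ pend st W)).
  apply: (@perm_map _ _ _ _ ((r, p, d) :: (O ++ pend st W))); apply/permP => b.
  by rewrite /= !count_cat /=; clear; lia.
have mem_R := perm_mem R_perm.
split; rewrite ?pE //.
- split=> [|w||] /=.
  + by rewrite p_W.
  + by rewrite inE W_dist; case: eqP => // _; rewrite d_ne0.
  + by rewrite p_n p_K.
  + rewrite eqxx d_gt0; apply/allP => w w_W /=; case: eqP => // _; exact: (allP W_gt0).
- split.
  + by rewrite (perm_uniq R_perm) /= r_R.
  + by rewrite mem_R inE negb_or eq_sym rs.
  + by move=> x; rewrite mem_R inE => /orP[/eqP->|/R_K].
  by move=> x; rewrite mem_R inE => /orP[/eqP->|/R_T].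
split=> //; rewrite -feas; apply: feasible_perm; apply/permP => b.
by rewrite /= !count_cat /= !count_cat; clear; lia.
Qed.

(** The new meeting point [p] is paid for by the two edges emitted with it, which preserves
    [2 * size B <= size O]. *)
Lemma attach_branch st T W B O r p d :
  attachable st T W B O r p d -> p \notin KX ++ B -> p \in W ->
  var st x_r = r -> var st x_p = p -> var st x_l = d ->
  core (run (incr x_keys ;; Put a_id (Var x_p) (Var x_keys) ;;
        emit (Get a_from (Var x_p)) (Var x_p) (Get a_dist (Var x_p)) ;;
        emit (Var x_r) (Var x_p) (Var x_l) ;;
        Put a_dist (Var x_p) #0) st) T (rem p W) (rcons B p)
    (rcons (rcons O (arr st a_from p, p, arr st a_dist p)) (r, p, d)) [::].
Proof.
move=> [core_st [r_K rs r_R rT] [p_R pr p_n d_gt0]] p_K p_W hr hp hd.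
have [[okK K_n okL] [uW W_dist W_n W_gt0] [simpL O_K O_ok] [uR s_R R_K R_T] [pot1 pot2 feas]] := core_st.
set q := arr st a_from p; set e := arr st a_dist p.
have e_gt0 : 0 < e := allP W_gt0 _ p_W.
have r_n : in_range r := allP K_n _ r_K.
have pW := perm_to_rem p_W.
have p_W' : p \notin rem p W by rewrite mem_rem_uniqF.
have pend_perm : perm_eq (pend st W) ((q, p, e) :: pend st (rem p W)) := perm_map _ pW.
have [q_K q_R] : q \in KX ++ B /\ q \in starts (O ++ pend st W).
  have q_R : q \in starts (O ++ pend st W).
    rewrite /starts map_cat mem_cat; apply/orP; right.
    by rewrite (perm_mem (perm_map _ pend_perm)) mem_head.
  by split=> //; exact: R_K.
have q_n : in_range q := allP K_n _ q_K.
have KB_E : (KX ++ D) ++ rcons B p = rcons ((KX ++ D) ++ B) p by rewrite rcons_cat.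
have p_new : p \notin (KX ++ D) ++ B by rewrite key_in_range.
set st1 := run (incr x_keys ;; Put a_id (Var x_p) (Var x_keys)) st.
have [_ keys_size _] := okK.
have ok1 : keys_ok st1 ((KX ++ D) ++ rcons B p).
  by rewrite KB_E; apply: keys_ok_rcons okK p_new _ _ => [|y] /=; rewrite keys_size // hp.
have LO_K : all (ends_in ((KX ++ D) ++ B)) (L0 ++ O).
  rewrite all_cat; apply/andP; split; apply/allP => c.
    by move=> /(allP L0_K) /andP[c1 c2]; rewrite /ends_in ![_ \in _ ++ B]mem_cat c1 c2.
  move=> /(allP O_K) /andP[c1 c2]; rewrite /ends_in !key_in_range ?c1 ?c2 //;
  exact: (allP K_n).
have out1 : out_ok st1 ((KX ++ D) ++ rcons B p) (L0 ++ O).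
  by rewrite KB_E; apply: out_ok_rcons_key => //; apply: out_ok_frame okL _ _.
have inK x : x \in KX ++ B -> x \in (KX ++ D) ++ rcons B p.
  move=> x_K; rewrite KB_E mem_rcons inE key_in_range ?x_K ?orbT //; exact: (allP K_n).
have p_K1 : p \in (KX ++ D) ++ rcons B p by rewrite KB_E mem_rcons mem_head.
have [|x y|x y x' y'|] := run_emit (ea := Get a_from (Var x_p)) (eb := Var x_p)
  (ed := Get a_dist (Var x_p)) (a := q) (b := p) (d := e) ok1 out1 (inK _ q_K) p_K1.
- by rewrite /= hp.
- by rewrite /= hp.
- by rewrite /= hp.
set st2 := run _ st1 => out2 v2 a2.
have ok2 : keys_ok st2 ((KX ++ D) ++ rcons B p).
  by apply: keys_ok_frame ok1 _ _; [exact: v2 | exact: a2].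
have [|x y|x y x' y'|] := run_emit (ea := Var x_r) (eb := Var x_p)
  (ed := Var x_l) (a := r) (b := p) (d := d) ok2 out2 (inK _ r_K) p_K1.
- by rewrite -hr; exact: v2.
- by rewrite -hp; exact: v2.
- by rewrite -hd; exact: v2.
set st3 := run _ st2 => out3 v3 a3.
have p3 : var st3 x_p = p by rewrite v3 // v2.
set st4 := run _ st; have st4E : st4 = set_arr st3 a_dist (var st3 x_p) 0 by [].
rewrite p3 in st4E; clearbody st4; clearbody st3; clearbody st2.
have v x : x != x_out -> var st4 x = var st1 x by move=> xk; rewrite st4E /= v3 // v2.
have a b : b != a_out -> b != a_dist -> arr st4 b =1 arr st1 b.
  by move=> ba bd x; rewrite st4E /= (negbTE bd) /= a3 // a2.
have dist4 x : arr st4 a_dist x = if x == p then 0 else arr st a_dist x.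
  by rewrite st4E /=; case: eqP => //= _; rewrite a3 // a2.
have from4 : arr st4 a_from =1 arr st a_from by move=> x; rewrite a.
have out4 : out_ok st4 ((KX ++ D) ++ rcons B p)
    (rcons (rcons (L0 ++ O) (q, p, e)) (r, p, d)).
  by apply: out_ok_frame out3 _ _; rewrite st4E.
have ok4 : keys_ok st4 ((KX ++ D) ++ rcons B p).
  by apply: keys_ok_frame ok1 _ _ => [|x]; rewrite ?v ?a.
have pE : pend st4 (rem p W) = pend st (rem p W).
  by apply/eq_in_map => w w_W'; rewrite from4 dist4; case: eqP w_W' p_W' => // -> ->.
clear st4E p3 st3 out3 v3 a3 ok2 st2 out2 v2 a2.
set O' := rcons (rcons O _) _.
have R_perm : perm_eq (starts (O' ++ pend st (rem p W))) (r :: starts (O ++ pend st W)).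
  apply: (@perm_map _ _ _ _ ((r, p, d) :: (O ++ pend st W))); apply/permP => b.
  by rewrite /= !count_cat (permP pend_perm) /= /O' -!cats1 !count_cat /=; clear; lia.
have mem_R := perm_mem R_perm.
have uR' : uniq (starts (O' ++ pend st (rem p W))) by rewrite (perm_uniq R_perm) /= r_R.
have R'_K : {subset starts (O' ++ pend st (rem p W)) <= KX ++ B}.
  by move=> x; rewrite mem_R inE => /orP[/eqP->|/R_K].
have sub_K : {subset KX ++ B <= KX ++ rcons B p}.
  by move=> x; rewrite !mem_cat mem_rcons inE => /orP[->//|->]; rewrite !orbT.
have p_KB : p \in KX ++ rcons B p by rewrite mem_cat mem_rcons mem_head orbT.
have [r_O p_O] : r \notin starts O /\ p \notin starts O.
  by move: r_R p_R; rewrite /starts !map_cat !mem_cat !negb_or => /andP[-> _] /andP[-> _].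
have qp : q != p by apply: contraNneq p_K => <-.
have rq : r != q by apply: contraNneq r_R => ->.
have q_O : q \notin starts O.
  move: uR; rewrite /starts map_cat cat_uniq => /and3P[_ /hasPn RO _]; apply: RO.
  by rewrite (perm_mem (perm_map _ pend_perm)) mem_head.
have starts_rcons c : starts (rcons O c) = rcons (starts O) c.1.1 by exact: map_rcons.
split; rewrite ?pE.
- split=> //; first by rewrite -rcons_cat all_rcons p_n.
  by move: out4; rewrite !rcons_cat.
- split; first exact: rem_uniq.
  + by move=> w; rewrite mem_rem_uniq // inE W_dist dist4 /=; case: eqP.
  + apply/allP => w w_W'; have /andP[-> w_K] := allP W_n _ (mem_rem w_W').
    rewrite -rcons_cat mem_rcons inE negb_or w_K andbT /=.
    by apply: contraNneq p_W' => w_p; rewrite -[X in X \in _]w_p.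
  apply/allP => w w_W'; rewrite dist4; case: eqP w_W' p_W' => [-> -> //|_ /mem_rem w_W _].
  exact: (allP W_gt0).
- split.
  + apply: simple_emit => //; first exact: simple_emit.
      by rewrite starts_rcons mem_rcons inE negb_or rq.
    by rewrite starts_rcons mem_rcons inE negb_or eq_sym qp.
  + rewrite !all_rcons /ends_in /= p_KB !sub_K //=; apply: sub_all O_K => c /andP[c1 c2].
    by rewrite /ends_in !sub_K.
  by rewrite !all_rcons /good_edge /= [r == p]eq_sym pr qp d_gt0 e_gt0.
- split=> //.
  + by rewrite mem_R inE negb_or eq_sym rs.
  + by move=> x /R'_K /sub_K.
  by move=> x; rewrite mem_R inE => /orP[/eqP->|/R_T].
(* The vertices [s], [p], [r] and all starts are distinct members of [KX ++ rcons B p]. As [W]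
   contains [p], this count gives the third alternative of the size condition for the enlarged [B]
   and [O]. *)
have count_R : (size W + size O + 3 <= size KX + size B + 1)%N.
  have s_K : s \in KX ++ rcons B p by rewrite sub_K // mem_cat sKX.
  have : (size [:: s, p, r & starts (O ++ pend st W)] <= size (KX ++ rcons B p))%N.
    apply: uniq_leq_size => [|x].
      rewrite /= r_R uR !inE !negb_or p_R s_R pr /= andbT [s == r]eq_sym rs /= andbT.
      by apply: contraNneq p_K => <-; rewrite mem_cat sKX.
    by rewrite !inE => /or4P[/eqP->|/eqP->|/eqP->|/R_K/sub_K] //; exact: sub_K.
  by rewrite /= /starts !map_cat !size_cat !size_map size_rcons; clear; lia.
have W_size : (0 < size W)%N by case: (W) p_W.
split; rewrite ?size_rcons.
- by move: pot1; clear; lia.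
- apply/or3P; apply: Or33; move: count_R W_size; clear; lia.
rewrite -feas; apply: feasible_perm; apply/permP => b.
by rewrite /= !count_cat (permP pend_perm) /= /O' -!cats1 !count_cat /=; clear; lia.
Qed.

Lemma run_attach st T W B O r p d : attachable st T W B O r p d ->
  var st x_r = r -> var st x_p = p -> var st x_l = d ->
  exists W' B' O', core (run attach st) T W' B' O' [::].
Proof.
move=> att hr hp hd.
have [[[okK K_n okL] [uW W_dist W_n W_gt0] _ _ _] _ [_ _ p_n _]] := att.
have -> : run attach st = if arr st a_id p == 0 then
    if arr st a_dist p == 0 then set_arr (set_arr st a_from p r) a_dist p d
    else run (incr x_keys ;; Put a_id (Var x_p) (Var x_keys) ;;
      emit (Get a_from (Var x_p)) (Var x_p) (Get a_dist (Var x_p)) ;;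
      emit (Var x_r) (Var x_p) (Var x_l) ;; Put a_dist (Var x_p) #0) st
  else run (emit (Var x_r) (Var x_p) (Var x_l)) st.
  by rewrite -hp -hr -hd.
rewrite (keys_ok_id _ okK) key_in_range //.
case: ifPn => [p_K|]; last first.
  rewrite negbK => p_K; exists W, B, (rcons O (r, p, d)).
  exact: attach_key att p_K hr hp hd.
case: eqVneq => [dist_p|dist_p].
  exists (p :: W), B, O; exact: attach_pending att p_K dist_p.
have p_W : p \in W by rewrite W_dist.
by do 3!eexists; exact: attach_branch att p_K p_W hr hp hd.
Qed.

Lemma attach_frame st :
  (forall a, a \in [:: a_in; a_deg; a_nbr; a_len] -> arr (run attach st) a =1 arr st a) /\
  (forall x, x \in [:: x_n; x_m; x_s; x_t; x_i; x_p] -> var (run attach st) x = var st x).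
Proof.
split=> [a|x]; rewrite !inE.
  by move=> /or4P[]/eqP-> x /=; do 2!case: ifP => //.
by do 5![case/orP => [/eqP->|]; first by rewrite /=; do 2!case: ifP => //] => /eqP-> /=;
  do 2!case: ifP => //.
Qed.

Lemma select_frame st :
  (forall a, a \in [:: a_in; a_deg; a_nbr; a_len] -> arr (run select st) a =1 arr st a) /\
  (forall x, x \in [:: x_n; x_m; x_s; x_t; x_i; x_p] -> var (run select st) x = var st x).
Proof.
split=> [a|x]; rewrite !inE.
  by move=> /or4P[]/eqP-> x /=; do 2!case: ifP => //.
by do 5![case/orP => [/eqP->|]; first by rewrite /=; do 2!case: ifP => //] => /eqP-> /=;
  do 2!case: ifP => //.
Qed.

Lemma core_unlink st T T' W B O v p d c :
  core st T W B O [::] -> perm_eq T (c :: T') -> c = (v, p, d) \/ c = (p, v, d) ->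
  [/\ core (run unlink st) T' W B O [:: (v, p, d)],
      v \notin starts (O ++ pend (run unlink st) W)
    & p \notin starts (O ++ pend (run unlink st) W)].
Proof.
move=> core_st pT c_vp; rewrite [pend (run unlink st) W](_ : _ = pend st W) //.
have [okK okW okO [uR s_R R_K R_T] [pot1 pot2 feas]] := core_st.
have c_T : c \in T by rewrite (perm_mem pT) mem_head.
(* Vertices that start an edge no longer touch [T], whereas both ends of [c] do. *)
have untouched x : touch x c -> x \notin starts (O ++ pend st W).
  by move=> xc; apply/negP => /R_T /allP /(_ c c_T) /=; rewrite xc.
split; last 2 first.
- by apply: untouched; case: c_vp => ->; rewrite /touch /= eqxx ?orbT.
- by apply: untouched; case: c_vp => ->; rewrite /touch /= eqxx ?orbT.
suff : core st T' W B O [:: (v, p, d)] by move=> h; apply: core_frame h _ _ _ _ _ _.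
split=> //; first split=> // r /R_T.
  by rewrite !(perm_all _ pT) /= => /andP[].
split=> //; rewrite -feas.
have perm_c : perm_eq ([::] ++ T ++ pend st W ++ L0 ++ O) (c :: T' ++ pend st W ++ L0 ++ O).
  by rewrite cat0s -(cat_cons c T') perm_cat2r.
rewrite (feasible_perm _ _ _ _ perm_c).
by case: c_vp => -> //; exact: feasible_flip.
Qed.

(** Every iteration either advances the scan or removes an edge of [T], so [n - i + size T]
    decreases. Up to the scan position, only the current vertex [v] may be a leaf. *)
Definition inv_peel (m : nat) (st : state) := base st /\
  exists (i : nat) (v : int) (T : seq edge) (W B : seq int) (O : seq edge),
  [/\ [/\ m = (n - i + size T)%N, (i <= n)%N, var st x_i = i%:Z & var st x_v = v],
      [/\ (i < n)%N -> in_range v, i = n -> v = n%:Z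
        & forall j : int, in_range j -> j <= i%:Z -> j != v -> arr st a_deg j != 1],
      [/\ uniq T, {subset T <= forest} & sums_ok T st]
    & core st T W B O [::]].

Lemma inv_peel_step m st : inv_peel m st -> holds st peel_test ->
  exists2 m', (m' < m)%N & inv_peel m' (run peel_body st).
Proof.
move=> [base_st [i [v [T [W [B [O [[m_E i_n hi hv] [v_in v_end deg_i]
  [uT T_forest sums_T] core_st]]]]]]]] i_lt.
have [hn _ _ _ _] := base_st.
have {}i_lt : (i < n)%N by move: i_lt; rewrite /= hi hn; clear; lia.
have v_n := v_in i_lt.
have -> : run peel_body st = if arr st a_deg v == 1 then
    run (unlink ;; select ;; If (Eq (Var x_l) #0) Skip attach ;; Assign x_v (Var x_p)) st
  else run (incr x_i ;; Assign x_v (Var x_i)) st.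
  by rewrite /peel_body -hv.
have [deg_v|deg_v] := eqVneq (arr st a_deg v) 1; last first.
  exists (n - i.+1 + size T)%N; first by rewrite m_E; move: i_lt; clear; lia.
  split; first by apply: base_frame base_st _ _ => // -[|[|[|[|]]]].
  exists i.+1, i.+1%:Z, T, W, B, O; split=> //.
  - by split=> //=; rewrite hi; clear; lia.
  - split=> [|->//|j j_n j_i j_ne]; first by rewrite /in_range; clear; lia.
    rewrite /=; have [->|j_v] := eqVneq j v; first exact: deg_v.
    by apply: deg_i => //; move: j_i j_ne; clear; lia.
have [p [d [c [T' [[_ p_n pv vs d_gt0] pT c_vp vT' [sums_T' hp hd]]]]]] :=
  run_unlink sums_T T_forest hv deg_v.
have [core1 v_R p_R] := core_unlink core_st pT c_vp.
have base1 : base (run unlink st).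
  by apply: base_frame base_st _ _ => // -[|[|[|[|]]]].
have hv1 : var (run unlink st) x_v = v by [].
have hi1 : var (run unlink st) x_i = i%:Z by [].
have [st1 st1E] : exists st1, st1 = run unlink st by exists (run unlink st).
move: sums_T' hp hd core1 v_R p_R base1 hv1 hi1; rewrite -st1E.
move=> sums1 hp1 hd1 core1 v_R p_R base1 hv1 hi1.
have [sel_a sel_v] := select_frame st1.
set st2 := run select st1 in sel_a sel_v.
have [att_a att_v] := attach_frame st2.
have -> : run (unlink ;; select ;; If (Eq (Var x_l) #0) Skip attach ;; Assign x_v (Var x_p)) st
    = run (Assign x_v (Var x_p)) (if var st2 x_l == 0 then st2 else run attach st2).
  by rewrite 3!run_seq run_if_eq -st1E.
have [W' [B' [O' core3]]] : exists W' B' O',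
    core (if var st2 x_l == 0 then st2 else run attach st2) T' W' B' O' [::].
  have [[l0 core2]|[W' [r [d' [l2 r2 att2]]]]] := run_select core1 hv1 hd1
    (And5 v_n p_n pv vs d_gt0) vT' v_R p_R.
    by exists W, B, O; rewrite l0.
  have [_ _ [_ _ _ d'_gt0]] := att2.
  rewrite ifF; last by rewrite l2; move: d'_gt0; clear; lia.
  apply: (run_attach att2) => //; by rewrite sel_v.
set st3 := if _ then _ else _ in core3 *.
have a3 a : a \in [:: a_in; a_deg; a_nbr; a_len] -> arr st3 a =1 arr st1 a.
  by move=> aP x; rewrite /st3; case: ifP => _; rewrite ?att_a // sel_a.
have v3 x : x \in [:: x_n; x_m; x_s; x_t; x_i; x_p] -> var st3 x = var st1 x.
  by move=> xP; rewrite /st3; case: ifP => _; rewrite ?att_v // sel_v.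
clearbody st3.
have p3 : var st3 x_p = p by rewrite v3.
have T'_T : {subset T' <= T} by move=> e e_T'; rewrite (perm_mem pT) inE e_T' orbT.
have sT : size T = (size T').+1 by rewrite (perm_size pT).
exists (n - i + size T')%N; first by rewrite m_E sT; clear; lia.
split.
  apply: base_frame base1 _ _ => [x x4|x] /=; last by rewrite a3.
  rewrite (_ : (x == x_v) = false) ?v3 //; first by case: x x4 => [|[|[|[|]]]].
  by move: x4; clear; lia.
exists i, p, T', W', B', O'; split.
- by split=> //=; rewrite ?v3.
- split=> // [i_eq|j j_n j_i jp]; first by move: i_lt; rewrite i_eq ltnn.
  rewrite /= a3 //; have [dg' _ _] := sums1; have [dg _ _] := sums_T.
  have [->|jv] := eqVneq j v.
    by rewrite dg' (nbsum_untouched _ vT') (negbTE vs).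
  have := deg_i j j_n j_i jv; rewrite dg dg' (nbsum_perm _ _ pT) nbsum_cons.
  have [vj pj] : (v == j) = false /\ (p == j) = false by rewrite ![_ == j]eq_sym (negbTE jv) (negbTE jp).
  by case: c_vp => -> /=; rewrite vj pj !mul0r !add0r.
- split.
  + by move: uT; rewrite (perm_uniq pT) => /andP[].
  + by move=> e /T'_T /T_forest.
  by have [dg nb ln] := sums1; split=> x; rewrite /= a3.
by apply: core_frame core3 _ _ _ _ _ _.
Qed.

Lemma exec_peel st0 :
  base st0 -> keys_ok st0 (KX ++ D) -> out_ok st0 (KX ++ D) L0 -> simple_edges L0 ->
  sums_ok forest st0 -> (forall a x, (7 < a)%N -> arr st0 a x = 0) ->
  var st0 x_i = 0 -> var st0 x_v = 0 ->
  (feasible (forest ++ L0) s t k (l + l) <-> feasible E s t k l) ->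
  exists N st W B O, [/\ exec (While peel_test peel_body) st0 N st,
    (N <= 300 * (n + size E) + 300)%N, base st & core st [::] W B O [::]].
Proof.
move=> base0 ok0 out0 simpL sums0 arr0 i0 v0 feas0.
have n_gt0 : (0 < n)%N by move: s_n; rewrite /in_range; clear; lia.
have [//|m st||N [m [st [ex N_le [base_st inv_st] ends]]]] :=
  @exec_while peel_test peel_body inv_peel _ _ (n + size forest) st0.
- exact: inv_peel_step.
- split=> //; exists 0%N, 0, forest, [::], [::], [::]; split.
  + by rewrite subn0.
  + split=> [_|n0|j j_n j_i j_ne]; first by rewrite /in_range; move: n_gt0; clear; lia.
      by rewrite -n0.
    by move: j_n j_i j_ne; rewrite /in_range; clear; lia.
  + by split.
  split; rewrite /= ?cats0 //; first by split=> // w; rewrite arr0.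
  by split=> //; clear; lia.
have [i [v [T [W [B [O [[m_E i_n hi hv] [v_in v_end deg_i] [uT T_forest sums_T] core_st]]]]]]] := inv_st.
have [hn _ _ _ _] := base_st.
have i_eq : i = n by move: ends; rewrite /= hi hn; move: i_n; clear; lia.
(* The scan has passed all vertices, so none except possibly [s] has degree one in [T]. *)
have T_nil : T = [::].
  apply: forest_peelable => // j j_n js; have [dg _ _] := sums_T.
  have jn : j < n%:Z by case/andP: j_n.
  have := deg_i j j_n; rewrite i_eq (v_end i_eq) dg (negbTE js) mulr0 addr0.
  by apply; rewrite ?(ltW jn) // lt_eqF.
rewrite T_nil in core_st.
have size_forest : (size forest <= size E)%N.
  by rewrite /forest size_map size_filter count_size.
exists N, st, W, B, O; split=> //.
apply: leq_trans N_le _; apply: (@leq_trans (300 * (n + size forest) + 300)%N).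
  by apply: leq_add => //; rewrite leq_mul2r; apply/orP; right.
by rewrite leq_add2r leq_mul2l leq_add2l size_forest orbT.
Qed.

(** With the forest exhausted, the end [w] of a pending chain touches nothing but this chain, and it
    can take the potential of the kept vertex [a_from w]. *)
Lemma feasible_drop_pend st W B O : core st [::] W B O [::] ->
  feasible (L0 ++ O) s t k (l + l) <-> feasible E s t k l.
Proof.
move=> [[okK K_n okL] [uW W_dist W_n W_gt0] [simpL O_K O_ok] [uR s_R R_K R_T] [pot1 pot2 <-]].
have inK x : x \in KX ++ B -> x \in (KX ++ D) ++ B.
  by move=> x_K; rewrite key_in_range // (allP K_n).
have LO_K c : c \in L0 ++ O -> (c.1.1 \in (KX ++ D) ++ B) && (c.1.2 \in (KX ++ D) ++ B).
  rewrite mem_cat => /orP[/(allP L0_K)|/(allP O_K)] /andP[c1 c2].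
    by rewrite ![_ \in _ ++ B]mem_cat c1 c2.
  by rewrite !inK.
split=> -[h [hl hk]]; last first.
  exists h; split=> //; by apply: le_trans hk; rewrite lez_nat /= [leqRHS]count_cat leq_addl.
pose h' x := if x \in (KX ++ D) ++ B then h x else h (arr st a_from x).
have [sK tK] : s \in (KX ++ D) ++ B /\ t \in (KX ++ D) ++ B by rewrite !mem_cat sKX tKX.
exists h'; rewrite /h' sK tK; split=> //.
apply: le_trans hk; rewrite /= count_cat (eq_in_count (a2 := pred0)) ?count_pred0.
  rewrite (eq_in_count (a2 := violated h)) // => c /LO_K /andP[c1 c2].
  by rewrite /violated /h' c1 c2.
move=> c /mapP[w w_W ->]; have /andP[w_n w_new] := allP W_n _ w_W.
have fK : arr st a_from w \in KX ++ B.
  by apply: R_K; rewrite /starts map_cat mem_cat -map_comp (map_f _ w_W) orbT.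
rewrite /violated /h' /= (inK _ fK) key_in_range // (negbTE w_new) subrr normr0.
by have := allP W_gt0 _ w_W; rewrite /=; clear; lia.
Qed.

(** As [s] and the starts are distinct, [size O + 1 <= size KX + size B]. With
    [2 * size B <= size O] and the size alternatives, [B] has at most [size KX - 2] members, or none
    when [size KX <= 1]. The midpoints add [size Fl] more keys. *)
Lemma core_size st W B O : core st [::] W B O [::] -> (size KX <= 2 * size Fl + 2)%N ->
  size D = size Fl ->
  (size ((KX ++ D) ++ B) <= 5 * size Fl + 2)%N /\ (size O <= 4 * size Fl + 2)%N.
Proof.
move=> [_ [uW _ W_n _] _ [uR s_R R_K _] [pot1 pot2 _]] KX_size D_size.
have : (size (s :: starts (O ++ pend st W)) <= size (KX ++ B))%N.
  apply: uniq_leq_size => [|x]; first by rewrite /= s_R.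
  by rewrite inE => /orP[/eqP->|/R_K //]; rewrite mem_cat sKX.
rewrite /= /starts !size_map !size_cat !size_map D_size.
by move: pot1 pot2 KX_size; clear; lia.
Qed.

End Peel.

(** * The whole program on integer edge lists *)

Lemma run_write_header st K L : base st -> keys_ok st K -> out_ok st K L ->
  s \in K -> t \in K ->
  let st' := run write_header st in
  [/\ arr st' a_out 0 = (size K)%:Z, arr st' a_out 1 = (size L)%:Z,
      arr st' a_out 2 = pos K s, arr st' a_out 3 = pos K t
    & [/\ arr st' a_out 4 = k, arr st' a_out 5 = l + l
      & forall j : nat, (j < size L)%N -> let c := nth edge0 L j in
        [/\ arr st' a_out (6 + (j%:Z + (j%:Z + j%:Z))) = pos K c.1.1,
            arr st' a_out (7 + (j%:Z + (j%:Z + j%:Z))) = pos K c.1.2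
          & arr st' a_out (8 + (j%:Z + (j%:Z + j%:Z))) = c.2]]].
Proof.
move=> [hn hm hs ht hin] [uK sK idK] [sL oL] s_K t_K.
have [_ _ _ [_ h4 h5]] := A0_header.
by split; rewrite /= ?sK ?sL ?hs ?ht ?idK ?s_K ?t_K ?hin ?h4 ?h5 //; clear; lia.
Qed.

Theorem kernel_program_correct st0 :
  arr st0 a_in =1 A0 -> (forall x, var st0 x = 0) ->
  (forall a x, (0 < a)%N -> arr st0 a x = 0) ->
  exists N st K L, [/\ exec kernel_program st0 N st, (N <= 3000 * (n + size E))%N,
    [/\ arr st a_out 0 = (size K)%:Z, arr st a_out 1 = (size L)%:Z,
        arr st a_out 2 = pos K s, arr st a_out 3 = pos K t
      & [/\ arr st a_out 4 = k, arr st a_out 5 = l + l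
        & forall j : nat, (j < size L)%N -> let c := nth edge0 L j in
          [/\ arr st a_out (6 + (j%:Z + (j%:Z + j%:Z))) = pos K c.1.1,
              arr st a_out (7 + (j%:Z + (j%:Z + j%:Z))) = pos K c.1.2
            & arr st a_out (8 + (j%:Z + (j%:Z + j%:Z))) = c.2]]],
    [/\ s \in K, t \in K, all (ends_in K) L, simple_edges L
      & all good_edge L]
  & [/\ (size K <= 5 * size Fl + 2)%N, (size L <= 6 * size Fl + 2)%N
    & feasible L s t k (l + l) <-> feasible E s t k l]].
Proof.
move=> in0 var0 arr0.
(* As [s] is a vertex, [n] is positive and absorbs the additive constants; the feedback edges are at
   most as many as all edges, so their loop is linear too. *)
have n_gt0 : (0 < n)%N by move: s_n; rewrite /in_range; clear; lia.
have Fl_E : (size Fl <= size E)%N by rewrite -count_Fl count_size.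
have [N0 N0_le ex0] := @exec_run read_header st0 isT.
have [N1 [st1 [ex1 N1_le base1 mul1 [arr1 keys1 out1]]]] := exec_mul in0 var0 arr0.
have [N2 N2_le ex2] := @exec_run start_keys st1 isT.
have inv2 := start_inv_fes base1 mul1 arr1 keys1 out1.
have i2 : var (run start_keys st1) x_i = 0 by [].
have [N3 [st3 [KX [ex3 N3_le base3 mul3 [[ok3 KX_n sKX tKX KX_size] keyedF fes3 out3 [deg3 arr3]]]]]] :=
  exec_fes inv2 i2.
have [N4 N4_le ex4] := @exec_run (Assign x_i #0) st3 isT.
have base4 : base (run (Assign x_i #0) st3).
  by apply: base_frame base3 _ _ => // -[|[|[|[|]]]].
have [N5 [st5 [D [L0 [ex5 N5_le base5 [ok5 D_size D_n sums5 arr5] [[okL0 L0_size simpL0 L0_K L0_ok] feas5]]]]]] :=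
  @exec_edge KX (run (Assign x_i #0) st3) KX_n sKX tKX keyedF base4 mul3 fes3 ok3 erefl out3 deg3 arr3.
have [N6 N6_le ex6] := @exec_run start_peel st5 isT.
have base6 : base (run start_peel st5).
  by apply: base_frame base5 _ _ => // -[|[|[|[|]]]].
have [N7 [st7 [W [B [O [ex7 N7_le base7 core7]]]]]] :=
  @exec_peel KX D L0 KX_n sKX tKX D_n L0_K L0_ok (run start_peel st5) base6 ok5 okL0 simpL0 sums5 arr5 erefl erefl feas5.
have [N8 N8_le ex8] := @exec_run write_header st7 isT.
have [K_le O_le] := core_size sKX core7 KX_size D_size.
have feas7 := feasible_drop_pend sKX tKX D_n L0_K core7.
have [[ok7 K_n okL7] _ [simpL O_K O_ok] _ _] := core7.
set K := (KX ++ D) ++ B in ok7 okL7 K_le.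
have [sK tK] : s \in K /\ t \in K by rewrite !mem_cat sKX tKX.
do 4!eexists; split.
- do 8!(apply: ExecSeq; first by eassumption); exact: ex8.
- move: n_gt0 Fl_E N0_le N1_le N2_le N3_le N4_le N5_le N6_le N7_le N8_le; rewrite /max_cost /expr_cost /=; clear; lia.
- exact: (run_write_header base7 ok7 okL7 sK tK).
- split=> //.
    rewrite all_cat; apply/andP; split; apply/allP => c.
      by move=> /(allP L0_K) /andP[c1 c2]; rewrite /ends_in ![_ \in K]mem_cat c1 c2.
    by move=> /(allP O_K) /andP[c1 c2]; rewrite /ends_in !(key_in_range KX D_n) ?c1 ?c2 // (allP K_n).
  by rewrite all_cat O_ok andbT; apply: sub_all L0_ok => c /andP[].
- split=> //; rewrite size_cat L0_size; move: O_le; clear; lia.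
Qed.

End Kernel.

(** * Encoded graphs as integer edge lists *)

Lemma pair_set_eq (V : finType) (a b x y : V) :
  a != b -> [set a; b] = [set x; y] -> (a, b) = (x, y) \/ (a, b) = (y, x).
Proof.
move=> ab e; have : a \in [set x; y] by rewrite -e set21.
have : b \in [set x; y] by rewrite -e set22.
by move=> /set2P[]b_eq /set2P[]a_eq; move: ab; rewrite a_eq b_eq ?eqxx // => _; [right | left].
Qed.

Lemma uniq_map_inj (T1 T2 : eqType) (f : T1 -> T2) s :
  uniq (map f s) -> {in s &, injective f}.
Proof.
elim: s => //= a s IH /andP[fa us] x y; rewrite !inE => /orP[/eqP->|xs] /orP[/eqP->|ys] // e.
- by case/negP: fa; rewrite e map_f.
- by case/negP: fa; rewrite -e map_f.
exact: IH.
Qed.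

Lemma nth_triples (L : seq edge) r j : (j < size L)%N ->
  let q := flatten [seq [:: c.1.1; c.1.2; c.2] | c : edge <- L] ++ r in
  [/\ nth 0 q (j + (j + j))%N = (nth edge0 L j).1.1,
      nth 0 q (j + (j + j)).+1 = (nth edge0 L j).1.2
    & nth 0 q (j + (j + j)).+2 = (nth edge0 L j).2].
Proof.
elim: L j => [|c L IH] [|j] // jL q.
have [e1 e2 e3] := IH j jL.
by rewrite (_ : (j.+1 + (j.+1 + j.+1) = (j + (j + j)).+3)%N) /=; last by clear; lia.
Qed.

Lemma size_triples (L : seq edge) :
  size (flatten [seq [:: c.1.1; c.1.2; c.2] | c : edge <- L]) = (size L + (size L + size L))%N.
Proof. by elim: L => //= c L ->; clear; lia. Qed.

Lemma nth_pairs (L : seq (int * int)) j : (j < size L)%N ->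
  let q := flatten [seq [:: e.1; e.2] | e : int * int <- L] in
  nth 0 q (j + j)%N = (nth edge0.1 L j).1 /\ nth 0 q (j + j).+1 = (nth edge0.1 L j).2.
Proof.
elim: L j => [|c L IH] [|j] // jL q.
have [e1 e2] := IH j jL.
by rewrite (_ : (j.+1 + j.+1 = (j + j).+2)%N) /=; last by clear; lia.
Qed.

Section Encoding.
Variables (I : instance) (F : {set {set 'I_(nv I)}}) (es fs : seq ('I_(nv I) * 'I_(nv I))).
Hypotheses (F_fes : feedback_edge_set (edges I) F).
Hypotheses (es_E : lists_edges (edges I) es) (fs_F : lists_edges F fs).

Definition int_edge (e : 'I_(nv I) * 'I_(nv I)) : edge :=
  (Posz e.1, Posz e.2, Posz (len I [set e.1; e.2])).
Definition int_pair (e : 'I_(nv I) * 'I_(nv I)) : int * int := (Posz e.1, Posz e.2).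

Let E := map int_edge es.
Let Fl := map int_pair fs.

Lemma mem_edges e : e \in es -> [set e.1; e.2] \in edges I.
Proof.
by move=> e_es; rewrite -mem_enum -(perm_mem es_E) (map_f (fun e => [set e.1; e.2]) e_es).
Qed.

Lemma ends_neq e : e \in es -> e.1 != e.2.
Proof.
by move=> /mem_edges /edges_simple; rewrite cards2; case: (e.1 != e.2).
Qed.

Lemma int_pair_inj : injective int_pair.
Proof. by move=> [a b] [x y] [/ord_inj-> /ord_inj->]. Qed.

Lemma listed_int_edge e : e \in es -> listed Fl (int_edge e) = ([set e.1; e.2] \in F).
Proof.
move=> e_es; have e_ne := ends_neq e_es.
rewrite /listed -[(int_edge e).1]/(int_pair e) -[(_, _)]/(int_pair (e.2, e.1)).
rewrite !(mem_map int_pair_inj) -[in RHS]mem_enum -(perm_mem fs_F).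
apply/orP/mapP => [[e_fs|e_fs]|[x x_fs /(pair_set_eq e_ne)]].
- by exists e.
- by exists (e.2, e.1); rewrite //= setUC.
by case: e {e_es e_ne} => a b; case: x x_fs => x y /= xy_fs [[-> ->]|[-> ->]]; [left | right].
Qed.

Lemma size_int_edges : size E = #|edges I|.
Proof. by rewrite size_map cardE -(perm_size es_E) size_map. Qed.

Lemma size_int_pairs : size Fl = #|F|.
Proof. by rewrite size_map cardE -(perm_size fs_F) size_map. Qed.

Lemma count_listed : count (listed Fl) E = size Fl.
Proof.
rewrite size_int_pairs count_map.
rewrite (eq_in_count (a2 := preim (fun e => [set e.1; e.2]) (mem F))) => [|e /listed_int_edge //].
rewrite -(count_map (fun e => [set e.1; e.2])) (permP es_E) -size_filter cardE.
apply/perm_size/uniq_perm => [||e]; [exact/filter_uniq/enum_uniq | exact: enum_uniq |].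
have [/subsetP FE _] := F_fes.
by rewrite mem_filter !mem_enum; apply/andP/idP => [[]//|e_F]; split; last exact: FE.
Qed.

Definition int_double (e : 'I_(nv I) * 'I_(nv I)) := double (int_edge e).

Lemma forest_int_edges :
  forest_edges Fl E = [seq int_double e | e <- es & [set e.1; e.2] \notin F].
Proof.
rewrite /forest_edges filter_map -map_comp; congr (map _ _).
by apply: eq_in_filter => e /listed_int_edge /= ->.
Qed.

Lemma int_double_inj : injective int_double.
Proof. by move=> [a b] [x y] [/ord_inj-> /ord_inj->]. Qed.

Lemma uniq_listed_sets : uniq [seq [set e.1; e.2] | e <- es].
Proof. by rewrite (perm_uniq es_E) enum_uniq. Qed.

Lemma uniq_forest : uniq (forest_edges Fl E).
Proof.
rewrite forest_int_edges (map_inj_uniq int_double_inj) filter_uniq //.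
exact: map_uniq uniq_listed_sets.
Qed.

(** If no vertex except possibly [s] has degree one in [T], every other vertex that has a neighbour
    has a second one. In a forest, [acyclic_edgeless] then leaves no edge. *)
Lemma forest_int_peelable s (T : seq edge) : in_segment (nv I) s ->
  uniq T -> {subset T <= forest_edges Fl E} ->
  (forall v, in_segment (nv I) v -> v != s -> nbsum (fun _ _ => 1) T v != 1) -> T = [::].
Proof.
move=> s_n uT T_forest deg_T.
have T_es c : c \in T -> exists2 e, e \in es & c = int_double e /\ [set e.1; e.2] \notin F.
  move=> /T_forest; rewrite forest_int_edges => /mapP[e].
  by rewrite mem_filter => /andP[e_F e_es] ->; exists e.
pose adjT : rel 'I_(nv I) := fun x y =>
  has (fun c : edge => (c.1 == int_pair (x, y)) || (c.1 == int_pair (y, x))) T.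
have adjTC : symmetric adjT by move=> x y; apply: eq_has => c /=; rewrite orbC.
have adjTP x y : adjT x y -> exists e, [/\ e \in es, int_double e \in T,
    [set e.1; e.2] \notin F & e = (x, y) \/ e = (y, x)].
  case/hasP => c c_T; have [e e_es [c_e e_F]] := T_es c c_T; rewrite c_e => e_xy.
  exists e; split; rewrite -?c_e //.
  by case/orP: e_xy => /eqP /int_pair_inj ->; [left | right].
have s_lt : (`|s| < nv I)%N by move: s_n; rewrite /in_segment; clear; lia.
have no_edge : forall x y, ~~ adjT x y.
  apply: (@acyclic_edgeless _ adjT (Ordinal s_lt)) => //.
  - move=> x; apply/negP => /adjTP[e [/ends_neq e_ne _ _]].
    by case=> e_x; rewrite e_x eqxx in e_ne.
  - move=> c /andP[cyc uc]; have [_ acyc] := F_fes; apply: acyc; apply/andP; split=> //.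
    apply: sub_cycle cyc => x y /adjTP[e [e_es _ e_F e_xy]].
    have -> : adj (edges I :\: F) x y = ([set e.1; e.2] \in edges I :\: F).
      by case: e_xy => ->; rewrite /adj //= setUC.
    by rewrite inE e_F mem_edges.
  move=> w u ws wu.
  have [z /andP[wz zu]|no_z] := pickP (fun z => adjT w z && (z != u)); first by exists z.
  have w_s : Posz w != s.
    by apply: contraNneq ws => w_s; apply/eqP/val_inj; rewrite /= -w_s.
  have w_n : in_segment (nv I) w by rewrite /in_segment /= ltz_nat.
  case/eqP: (deg_T w w_n w_s).
  (* If [u] is the only neighbour of [w], any edge of [T] at [w] has the ends [w] and [u]; each edge
     is listed once, so [w] has degree one. *)
  have [e [e_es e_T e_F e_wu]] := adjTP _ _ wu.
  rewrite (nbsum_perm _ _ (perm_to_rem e_T)) nbsum_cons nbsum_untouched.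
    have := ends_neq e_es; rewrite -(inj_eq val_inj) /=.
    by case: e_wu => -> /=; clear; lia.
  apply/allP => c; rewrite mem_rem_uniq // inE => /andP[c_ne c_T]; apply/negP => cw.
  have [e' e'_es [c_e' _]] := T_es c c_T.
  suff e'_wu : [set e'.1; e'.2] = [set w; u].
    case/eqP: c_ne; rewrite c_e'; congr int_double.
    apply: (uniq_map_inj uniq_listed_sets) => //; rewrite e'_wu.
    by case: e_wu => ->; rewrite //= setUC.
  have adj_z z : e' = (w, z) \/ e' = (z, w) -> z = u.
    move=> e'_wz; apply/eqP; move/negbT: (no_z z); rewrite negb_and negbK => /orP[|//].
    case/negP; apply/hasP; exists c => //; rewrite c_e'.
    by case: e'_wz => ->; rewrite eqxx ?orbT.
  move: cw adj_z; rewrite c_e' /touch /=; case: e' {c_e' e'_es} => a b /= /orP[]/eqP[] /val_inj ->.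
    by move=> /(_ b (or_introl erefl)) ->.
  by move=> /(_ a (or_intror erefl)) ->; rewrite setUC.
case T_c : T => [//|c T2]; have c_T : c \in T by rewrite T_c mem_head.
have [e _ [c_e _]] := T_es c c_T; case/negP: (no_edge e.1 e.2).
by apply/hasP; exists c; rewrite // c_e eqxx.
Qed.

Lemma sp_mve_int_edges : feasible E (src I) (tgt I) (budget I) (bound I) <-> sp_mve I.
Proof.
rewrite (sp_mve_feasible es_E).
rewrite -(@feasible_map _ _ (fun x : 'I_(nv I) => Posz x)
  (fun x => insubd (src I) `|x|%N) predT) //.
- by rewrite -map_comp.
- by move=> x _; apply: val_inj; rewrite /= val_insubd ltn_ord.
by apply/allP.
Qed.

End Encoding.

(** * The output as an instance, and the final bounds *)

Lemma instance_of_edges (K : seq int) (L : seq edge) (s t k l : int) :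
  s \in K -> t \in K -> all (ends_in K) L -> simple_edges L -> all good_edge L ->
  exists (I' : instance) (es' : seq ('I_(nv I') * 'I_(nv I'))),
  [/\ nv I' = size K, #|edges I'| = size L, lists_edges (edges I') es',
      encode I' es' = [:: Posz (size K); Posz (size L); Posz (pos K s); Posz (pos K t); k; l]
        ++ flatten [seq [:: c.1.1; c.1.2; c.2] |
                    c : edge <- [seq (Posz (pos K c.1.1), Posz (pos K c.1.2), c.2) | c <- L]]
    & sp_mve I' <-> feasible L s t k l].
Proof.
move=> sK tK /allP L_K simpL /allP L_ok.
have pos_lt x : x \in K -> (pos K x < size K)%N by rewrite index_mem.
(* The default of [insubd] is never taken at a kept vertex, whose position is below [size K]. *)
pose idx x : 'I_(size K) := insubd (Ordinal (pos_lt s sK)) (pos K x).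
have idxE x : x \in K -> idx x = pos K x :> nat by move=> xK; rewrite val_insubd pos_lt.
have idxK : {in K, cancel idx (fun i : 'I_(size K) => nth 0 K i)}.
  by move=> x xK; rewrite idxE // nth_index.
have idx_inj x y : x \in K -> y \in K -> idx x = idx y :> 'I_(size K) -> x = y.
  by move=> xK yK e; rewrite -(idxK x xK) e idxK.
have idx_ne x y : x \in K -> y \in K -> x != y -> idx x != idx y.
  by move=> xK yK; apply: contra => /eqP /(idx_inj x y xK yK) ->.
pose L' := [seq (idx c.1.1, idx c.1.2, c.2) | c : edge <- L].
have L'_ok : all (fun c : 'I_(size K) * 'I_(size K) * int => (c.1.1 != c.1.2) && (0 < c.2)%R) L'.
  rewrite all_map; apply/allP => c c_L /=; have /andP[c_ne ->] := L_ok c c_L.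
  by have /andP[c1 c2] := L_K c c_L; rewrite andbT; apply: idx_ne.
have L'_uniq : uniq [seq [set c.1.1; c.1.2] | c : 'I_(size K) * 'I_(size K) * int <- L'].
  rewrite -map_comp uniq_pairwise pairwise_map.
  apply: (@sub_in_pairwise _ (mem L) _ _ _ L _ simpL); last by apply/allP.
  move=> a b a_L b_L /=; apply: contra => /eqP e.
  have /andP[a1 a2] := L_K a a_L; have /andP[b1 b2] := L_K b b_L.
  have /andP[a_ne _] := L_ok a a_L.
  rewrite /same_ends [a.1]surjective_pairing [b.1]surjective_pairing !xpair_eqE.
  have [[e1 e2]|[e1 e2]] := pair_set_eq (idx_ne _ _ a1 a2 a_ne) e.
    by rewrite (idx_inj _ _ a1 b1 e1) (idx_inj _ _ a2 b2 e2) !eqxx.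
  by rewrite (idx_inj _ _ a1 b2 e1) (idx_inj _ _ a2 b1 e2) !eqxx orbT.
have [I' [es' [nvE edgesE es'_E encE spE]]] := kernel_instance (idx s) (idx t) k l L'_ok L'_uniq.
exists I', es'; split=> //.
- by rewrite edgesE size_map.
- rewrite encE size_map !idxE // -!map_comp; congr (_ ++ flatten _).
  apply/eq_in_map => c /L_K /andP[c1 c2] /=; by rewrite !idxE.
rewrite spE; exact: (@feasible_map _ _ idx (fun i => nth 0 K i) _ L s t k l idxK sK tK (introT allP L_K)).
Qed.

Lemma kernel_program_linear (I : instance) (F : {set {set 'I_(nv I)}})
    (es fs : seq ('I_(nv I) * 'I_(nv I))) :
  feedback_edge_set (edges I) F -> lists_edges (edges I) es -> lists_edges F fs ->
  exists time st (I' : instance) (es' : seq ('I_(nv I') * 'I_(nv I'))),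
  [/\ exec kernel_program (init_state (encode I es ++ encode_edge_set fs)) time st,
      (time <= 3000 * (nv I + #|edges I|))%N,
      lists_edges (edges I') es' /\ has_output st (encode I' es'),
      sp_mve I <-> sp_mve I'
    & (nv I' <= 5 * #|F| + 2)%N /\ (#|edges I'| <= 6 * #|F| + 2)%N].
Proof.
move=> F_fes es_E fs_F.
pose E := map (@int_edge I) es; pose Fl := map (@int_pair I) fs.
pose input := encode I es ++ encode_edge_set fs.
have inputE : input = [:: Posz (nv I); Posz (size E); Posz (src I); Posz (tgt I);
    budget I; bound I] ++ (flatten [seq [:: c.1.1; c.1.2; c.2] | c : edge <- E]
    ++ Posz (size Fl) :: flatten [seq [:: e.1; e.2] | e : int * int <- Fl]).
  by rewrite /input /encode /encode_edge_set /E /Fl !size_map -!map_comp -catA.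
pose A0 := arr (init_state input) input_array.
have A0E (q : nat) : A0 (Posz q) = nth 0 input q by [].
have in_n (x : 'I_(nv I)) : in_segment (nv I) x by rewrite /in_segment /= ltz_nat.
have E_ok : all (fun c : edge => [&& in_segment (nv I) c.1.1, in_segment (nv I) c.1.2,
    c.1.1 != c.1.2 & 0 < c.2]) E.
  rewrite all_map; apply/allP => e e_es /=; rewrite !in_n /= ltz_nat.
  rewrite len_gt0 ?(mem_edges es_E) // andbT eqz_nat val_eqE.
  exact: (ends_neq es_E e_es).
have Fl_n : all (fun e => in_segment (nv I) e.1 && in_segment (nv I) e.2) Fl.
  by rewrite all_map; apply/allP => e _ /=; rewrite !in_n.
have header : [/\ A0 0 = (nv I)%:Z, A0 1 = (size E)%:Z, A0 2 = src I
    & [/\ A0 3 = tgt I, A0 4 = budget I & A0 5 = bound I]].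
  by rewrite (A0E 0%N : A0 0 = _) (A0E 1%N : A0 1 = _) (A0E 2%N : A0 2 = _)
    (A0E 3%N : A0 3 = _) (A0E 4%N : A0 4 = _) (A0E 5%N : A0 5 = _) inputE.
have A0_edge j : (j < size E)%N -> let c := nth edge0 E j in
    [/\ A0 (6 + (j%:Z + (j%:Z + j%:Z))) = c.1.1, A0 (7 + (j%:Z + (j%:Z + j%:Z))) = c.1.2
      & A0 (8 + (j%:Z + (j%:Z + j%:Z))) = c.2].
  move=> jE c; have [e1 e2 e3] := nth_triples
    (Posz (size Fl) :: flatten [seq [:: e.1; e.2] | e : int * int <- Fl]) jE.
  split.
  - by rewrite (A0E (6 + (j + (j + j)))%N : A0 (6 + (j%:Z + (j%:Z + j%:Z))) = _) inputE -e1.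
  - by rewrite (A0E (7 + (j + (j + j)))%N : A0 (7 + (j%:Z + (j%:Z + j%:Z))) = _) inputE -e2.
  by rewrite (A0E (8 + (j + (j + j)))%N : A0 (8 + (j%:Z + (j%:Z + j%:Z))) = _) inputE -e3.
(* Six header cells and three cells per edge precede the encoding of the feedback edge set. *)
have tailE i : nth 0 input (6 + (size E + (size E + size E) + i))%N =
    nth 0 (Posz (size Fl) :: flatten [seq [:: e.1; e.2] | e : int * int <- Fl]) i.
  rewrite inputE -[LHS]/(nth 0 (_ ++ _) (size E + (size E + size E) + i)).
  by rewrite nth_cat size_triples ltnNge leq_addr addKn.
have A0_size : A0 (6 + ((size E)%:Z + ((size E)%:Z + (size E)%:Z))) = (size Fl)%:Z.
  rewrite (_ : 6 + _ = Posz (6 + (size E + (size E + size E) + 0))%N); last by clear; lia.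
  by rewrite A0E tailE.
have A0_Fl j : (j < size Fl)%N -> let e := nth edge0.1 Fl j in
    A0 (7 + ((size E)%:Z + ((size E)%:Z + (size E)%:Z)) + (j%:Z + j%:Z)) = e.1 /\
    A0 (8 + ((size E)%:Z + ((size E)%:Z + (size E)%:Z)) + (j%:Z + j%:Z)) = e.2.
  move=> jF e; have [e1 e2] := nth_pairs jF.
  rewrite (_ : 7 + _ + _ = Posz (6 + (size E + (size E + size E) + (j + j).+1))%N); last by clear; lia.
  rewrite (_ : 8 + _ + _ = Posz (6 + (size E + (size E + size E) + (j + j).+2))%N); last by clear; lia.
  by rewrite !A0E !tailE /= e1 e2.
have [N [st [K [L [ex N_le out [sK tK L_K simpL L_ok] [K_le L_le feas]]]]]] :=
  @kernel_program_correct (nv I) (src I) (tgt I) (budget I) (bound I) E Fl A0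
    (in_n _) (in_n _) E_ok Fl_n (count_listed F_fes es_E fs_F) (uniq_forest es_E fs_F)
    (fun T => @forest_int_peelable I F es fs F_fes es_E fs_F (src I) T (in_n _))
    header A0_edge A0_size A0_Fl (init_state input) (fun=> erefl) (fun=> erefl)
    (fun a x => ltac:(by case: a)).
have [I' [es' [nvE edgesE es'_E encE spE]]] :=
  instance_of_edges (budget I) (bound I + bound I) sK tK L_K simpL L_ok.
exists N, st, I', es'; split.
- exact: ex.
- by rewrite -(size_int_edges es_E).
- split=> //; rewrite encE.
  have [o0 o1 o2 o3 [o4 o5 oL]] := out.
  set L' := [seq _ | c <- L].
  case=> [|[|[|[|[|[|j]]]]]] // j_lt.
  have {}j_lt : (j < size L + (size L + size L))%N.
    by move: j_lt; rewrite size_cat size_triples size_map /=; clear; lia.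
  (* After the header, cell [j] belongs to edge number [j %/ 3]; the remainder selects one of the
     ends or the length. *)
  pose q := (j %/ 3)%N.
  have qL : (q < size L)%N by move: j_lt; rewrite /q; clear; lia.
  have qL' : (q < size L')%N by rewrite size_map.
  have [p1 p2 p3] := oL q qL.
  have [e1 e2 e3] := nth_triples [::] qL'.
  rewrite cats0 (nth_map edge0) //= in e1 e2 e3.
  have [j_q|[j_q|j_q]] : j = (q + (q + q))%N \/ j = (q + (q + q)).+1 \/ j = (q + (q + q)).+2.
    by rewrite /q; clear; lia.
  + by rewrite j_q /= e1 -p1.
  + by rewrite j_q /= e2 -p2.
  + by rewrite j_q /= e3 -p3.
- rewrite spE feas; apply: iff_sym; exact: sp_mve_int_edges es_E.
- by rewrite edgesE -(size_int_pairs fs_F); split; [rewrite nvE | exact: L_le].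
Qed.

Local Close Scope ring_scope.

Theorem theorem13 :
  has_linear_time_kernel (fun f => 5 * f + 2) (fun f => 6 * f + 2).
Proof.
by exists kernel_program, 3000 => I F es fs; exact: kernel_program_linear.
Qed.
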